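(* Let $w=\log_2 7$. There is a parallel algorithm (called Strassen-W) in the binary-forking model without locks and atomic instructions that multiplies two $n\times n$ matrices using the arithmetic of Strassen's recursive matrix multiplication algorithm and has $O(n^w)$ work, $O(\log n\cdot\log\log\log n)$ span, and $O(n^w/\log\log n)$ space.
   Context: Binary-forking model: a computation starts with a single thread; any thread may fork a concurrent asynchronous child thread, recursively, and threads are synchronized by join operations; the computation is a series-parallel DAG. No locks and no atomic instructions are used. Work is the total number of instructions; span is the length of the longest path in the DAG; space is the memory allocated (from the heap). Strassen's algorithm multiplies $n\times n$ matrices by splitting each into $2\times2$ blocks, forming 7 recursive half-size block products of linear combinations of input blocks, and combining them linearly into output blocks. *)

(* Defs.v *)
From HB Require Import structures.
From mathcomp Require Import all_boot all_order all_algebra.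
From mathcomp Require Import reals exp.
Set Implicit Arguments.
Unset Strict Implicit.
Unset Printing Implicit Defensive.
Import GRing.Theory.

(* (block identifier, offset inside the block) *)
Definition loc : Type := (nat * nat)%type.

Section Dag.
Variable R : pzRingType.

(* A dag is given by its series-parallel decomposition:
   - [Local m] is a chain of [m] instructions on thread-private registers;
   - [Access rs ws ms] is one memory instruction that reads the locations [rs],
     writes the locations [ws] and performs the ring multiplications [ms]
     (a list of operand pairs, of length at most 1);
   - [Fork s t] is a fork node, the two branches in parallel, and a join node;
   - [Heap b k t] allocates a block [b] of [k] cells, runs [t], releases [b]. *)
Inductive dag : Type :=
| Local of nat
| Access of seq loc & seq loc & seq (R * R)
| Ser of dag & dag
| Fork of dag & dag
| Heap of nat & nat & dag.

Fixpoint dag_work (t : dag) : nat :=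
  match t with
  | Local m => m
  | Access _ _ _ => 1
  | Ser s t => dag_work s + dag_work t
  | Fork s t => (dag_work s + dag_work t).+2
  | Heap _ _ t => (dag_work t).+2
  end.

(* Number of nodes on a longest path. *)
Fixpoint dag_span (t : dag) : nat :=
  match t with
  | Local m => m
  | Access _ _ _ => 1
  | Ser s t => dag_span s + dag_span t
  | Fork s t => (maxn (dag_span s) (dag_span t)).+2
  | Heap _ _ t => (dag_span t).+2
  end.

(* Maximum, over all schedules, of the number of simultaneously allocated heap
   cells: two parallel branches may reach their own maxima at the same time. *)
Fixpoint dag_space (t : dag) : nat :=
  match t with
  | Local _ | Access _ _ _ => 0
  | Ser s t => maxn (dag_space s) (dag_space t)
  | Fork s t => dag_space s + dag_space t
  | Heap _ k t => k + dag_space t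
  end.

(* Footprints. Locations of a block allocated inside [t] are not part of the
   footprint of [t]: block identifiers are only unique along a nest of live
   blocks, so parallel branches may use the same one for distinct blocks. *)
Fixpoint written (t : dag) : seq loc :=
  match t with
  | Local _ => [::]
  | Access _ ws _ => ws
  | Ser s t | Fork s t => written s ++ written t
  | Heap b _ t => [seq l <- written t | l.1 != b]
  end.

Fixpoint touched (t : dag) : seq loc :=
  match t with
  | Local _ => [::]
  | Access rs ws _ => rs ++ ws
  | Ser s t | Fork s t => touched s ++ touched t
  | Heap b _ t => [seq l <- touched t | l.1 != b]
  end.

(* No location written by one of two parallel branches is accessed by the
   other one; concurrent reads are allowed. *)
Fixpoint race_free (t : dag) : bool :=
  match t with
  | Local _ | Access _ _ _ => true
  | Ser s t => race_free s && race_free t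
  | Fork s t => [&& race_free s, race_free t,
                    ~~ has (mem (touched t)) (written s) &
                    ~~ has (mem (touched s)) (written t)]
  | Heap _ _ t => race_free t
  end.

Fixpoint mults (t : dag) : seq (R * R) :=
  match t with
  | Local _ => [::]
  | Access _ _ ms => ms
  | Ser s t | Fork s t => mults s ++ mults t
  | Heap _ _ t => mults t
  end.

End Dag.

Arguments Local {R}.
Arguments Access {R}.

(* Registers hold machine words (natural numbers below a bound), subtraction is
   truncated and [x %/ 0 = 0]. Variables are de Bruijn indices. *)
Inductive wop := WAdd | WSub | WMul | WDiv.

Inductive expr :=
| Var of nat
| Cst of nat
| Bin of wop & expr & expr.

(* [Cell x e] is cell number [e] of the array variable [x]. Array variables
   hold block identifiers, which programs can pass around but not inspect. *)
Inductive cell := Cell of nat & expr.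

Inductive rop := RAdd | RSub | RMul.

(* Ring elements live only in memory, never in registers, so that all of the
   data of the algorithm is accounted for by [dag_space]. There is no lock and no
   atomic read-modify-write instruction: threads synchronize only by the join
   at the end of [Par]. *)
Inductive cmd :=
| Skip
| Seq of cmd & cmd
| Let of expr & cmd                        (* binds word variable 0 *)
| IfLe of expr & expr & cmd & cmd
| Par of cmd & cmd
| New of expr & cmd                        (* binds array variable 0 *)
| Call of nat & seq expr & seq nat         (* procedure, words, arrays *)
| Zero of cell
| Move of cell & cell
| Arith of rop & cell & cell & cell.       (* destination first *)

Record program := Program { procs : seq cmd; main : cmd }.

Definition wop_fun (o : wop) : nat -> nat -> nat :=
  match o with WAdd => addn | WSub => subn | WMul => muln | WDiv => divn end.

Definition word_check (w v : nat) : option nat := if v < w then Some v else None.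

(* Every intermediate result must be a word, i.e. smaller than [w]. *)
Fixpoint eval (w : nat) (env : seq nat) (e : expr) : option nat :=
  match e with
  | Var x => onth env x
  | Cst v => word_check w v
  | Bin o e1 e2 =>
      match eval w env e1, eval w env e2 with
      | Some v1, Some v2 => word_check w (wop_fun o v1 v2)
      | _, _ => None
      end
  end.

Fixpoint cost (e : expr) : nat :=
  match e with
  | Var _ | Cst _ => 1
  | Bin _ e1 e2 => (cost e1 + cost e2).+1
  end.

Definition costs (es : seq expr) : nat := sumn (map cost es).

(* Arrays are indexed by [aenv : seq nat], the block identifiers in scope. *)
Definition locate (w : nat) (env aenv : seq nat) (c : cell) : option loc :=
  let: Cell x e := c in
  match onth aenv x, eval w env e with
  | Some b, Some i => Some (b, i)
  | _, _ => None
  end.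

Definition ccost (c : cell) : nat := let: Cell _ e := c in (cost e).+1.

Section Exec.
Variable R : pzRingType.

Definition rop_fun (o : rop) (x y : R) : R :=
  match o with RAdd => x + y | RSub => x - y | RMul => x * y end%R.

Definition rop_mults (o : rop) (x y : R) : seq (R * R) :=
  if o is RMul then [:: (x, y)] else [::].

(* The block with identifier [b] is the [b]-th one; an uninitialized cell is
   [None]. *)
Definition heap : Type := seq (seq (option R)).

Definition valid (h : heap) (l : loc) : bool := l.2 < size (nth [::] h l.1).

Definition load (h : heap) (l : loc) : option R := nth None (nth [::] h l.1) l.2.

Definition store (h : heap) (l : loc) (v : R) : heap :=
  set_nth [::] h l.1 (set_nth None (nth [::] h l.1) l.2 (Some v)).

Variables (P : seq cmd) (w : nat).

(* [exec env aenv h c h' t]: from the heap [h], the command [c] terminates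
   without error in the heap [h'] and its computation dag is [t]. In the rule
   for [Par] the branches are run one after the other, which gives the outcome
   of every schedule as soon as [t] is race-free. Memory allocation takes one
   instruction and does not initialize the cells. Out-of-bounds accesses, reads
   of uninitialized cells and word overflows have no rule. *)
Inductive exec : seq nat -> seq nat -> heap -> cmd -> heap -> dag R -> Prop :=
| exec_skip env aenv h :
    exec env aenv h Skip h (Local 0)
| exec_seq env aenv h c1 h1 t1 c2 h2 t2 :
    exec env aenv h c1 h1 t1 ->
    exec env aenv h1 c2 h2 t2 ->
    exec env aenv h (Seq c1 c2) h2 (Ser t1 t2)
| exec_let env aenv h e v c h' t :
    eval w env e = Some v ->
    exec (v :: env) aenv h c h' t ->
    exec env aenv h (Let e c) h' (Ser (Local (cost e)) t)
| exec_if env aenv h e1 v1 e2 v2 c1 c2 h' t :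
    eval w env e1 = Some v1 ->
    eval w env e2 = Some v2 ->
    exec env aenv h (if v1 <= v2 then c1 else c2) h' t ->
    exec env aenv h (IfLe e1 e2 c1 c2) h'
         (Ser (Local (cost e1 + cost e2).+1) t)
| exec_par env aenv h c1 h1 t1 c2 h2 t2 :
    exec env aenv h c1 h1 t1 ->
    exec env aenv h1 c2 h2 t2 ->
    exec env aenv h (Par c1 c2) h2 (Fork t1 t2)
| exec_new env aenv h e k c h' t :
    eval w env e = Some k ->
    exec env (size h :: aenv) (rcons h (nseq k None)) c h' t ->
    exec env aenv h (New e c) (take (size h) h')
         (Ser (Local (cost e)) (Heap (size h) k t))
| exec_call env aenv h p es xs c vs bs h' t :
    onth P p = Some c ->
    map (eval w env) es = map Some vs ->
    map (onth aenv) xs = map Some bs ->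
    exec vs bs h c h' t ->
    exec env aenv h (Call p es xs) h' (Ser (Local (costs es + size xs).+1) t)
| exec_zero env aenv h d l :
    locate w env aenv d = Some l -> valid h l ->
    exec env aenv h (Zero d) (store h l 0%R)
         (Ser (Local (ccost d)) (Access [::] [:: l] [::]))
| exec_move env aenv h d a l la x :
    locate w env aenv d = Some l -> valid h l ->
    locate w env aenv a = Some la -> load h la = Some x ->
    exec env aenv h (Move d a) (store h l x)
         (Ser (Local (ccost d + ccost a)) (Access [:: la] [:: l] [::]))
| exec_arith env aenv h o d a b l la lb x y :
    locate w env aenv d = Some l -> valid h l ->
    locate w env aenv a = Some la -> load h la = Some x ->
    locate w env aenv b = Some lb -> load h lb = Some y ->
    exec env aenv h (Arith o d a b) (store h l (rop_fun o x y))
         (Ser (Local (ccost d + ccost a + ccost b))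
              (Access [:: la; lb] [:: l] (rop_mults o x y))).

End Exec.

(* An execution is determined by the program and its input, so the existence of
   an execution with some property means that the execution has it. *)
Lemma exec_det (R : pzRingType) P w env aenv (h : heap R) c h1 t1 h2 t2 :
  exec P w env aenv h c h1 t1 -> exec P w env aenv h c h2 t2 ->
  h1 = h2 /\ t1 = t2.
Proof.
have injS : injective (@Some nat) by move=> ? ? [].
move=> E; elim: E h2 t2 => {env aenv h c h1 t1}; intros;
  match goal with H : exec _ _ _ _ _ _ _ _ |- _ => inversion H; clear H; subst end;
  repeat match goal with
  | H1 : ?x = Some _, H2 : ?x = Some _ |- _ =>
      rewrite H1 in H2; injection H2 => *; subst; clear H2
  | H1 : map _ _ = map Some ?s1, H2 : map _ _ = map Some ?s2 |- _ =>
      move: (etrans (esym H1) H2) => /(inj_map injS) ?; subst s2; clear H2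
  end; subst;
  repeat match goal with
  | IH : forall _ _, exec _ _ _ _ _ _ _ _ -> _, H : exec _ _ _ _ _ _ _ _ |- _ =>
      have [? ?] := IH _ _ H; clear H; subst
  end; by [].
Qed.

Definition row_major (R : pzRingType) (n : nat) (A : 'M[R]_n) : seq (option R) :=
  [seq Some (A i j) | i <- enum 'I_n, j <- enum 'I_n].

(* On [n] x [n] matrices [A] and [B], the program [P] is started with [n] in its
   only register and three arrays: [A] and [B] in row-major order, and an
   uninitialized one which must receive the product. The inputs must be intact
   in the end. *)
Definition multiplies (R : pzRingType) (P : program) (w n : nat)
    (A B : 'M[R]_n) (t : dag R) : Prop :=
  exec (procs P) w [:: n] [:: 0; 1; 2]
    [:: row_major A; row_major B; nseq (n * n) None] (main P)
    [:: row_major A; row_major B; row_major (A *m B)%R] t.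

(* [pow2 d] is [2 ^ d], in a form for which halves are definitional. *)
Fixpoint pow2 (d : nat) : nat := if d is d.+1 then pow2 d + pow2 d else 1.

Lemma pow2E d : pow2 d = 2 ^ d.
Proof. by elim: d => //= d ->; rewrite expnS mul2n addnn. Qed.

Section Strassen.
Variable R : pzRingType.
Local Open Scope ring_scope.

Definition strassen_operands m (A B : 'M[R]_(m + m)) : seq ('M[R]_m * 'M[R]_m) :=
  let A11 := ulsubmx A in let A12 := ursubmx A in
  let A21 := dlsubmx A in let A22 := drsubmx A in
  let B11 := ulsubmx B in let B12 := ursubmx B in
  let B21 := dlsubmx B in let B22 := drsubmx B in
  [:: (A11 + A22, B11 + B22); (A21 + A22, B11); (A11, B12 - B22);
      (A22, B21 - B11); (A11 + A12, B22); (A21 - A11, B11 + B12);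
      (A12 - A22, B21 + B22)].

Definition strassen_combine m (M : seq 'M[R]_m) : 'M[R]_(m + m) :=
  let M1 := M`_0 in let M2 := M`_1 in let M3 := M`_2 in let M4 := M`_3 in
  let M5 := M`_4 in let M6 := M`_5 in let M7 := M`_6 in
  block_mx (M1 + M4 - M5 + M7) (M3 + M5) (M2 + M4) (M1 - M2 + M3 + M6).

Lemma strassen_combineE m (A B : 'M[R]_(m + m)) :
  strassen_combine [seq ST.1 *m ST.2 | ST <- strassen_operands A B] = A *m B.
Proof.
rewrite /strassen_combine /= -[in RHS](submxK A) -[in RHS](submxK B) mulmx_block.
move: (ulsubmx A) (ursubmx A) (dlsubmx A) (drsubmx A) => A11 A12 A21 A22.
move: (ulsubmx B) (ursubmx B) (dlsubmx B) (drsubmx B) => B11 B12 B21 B22.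
rewrite !(mulmxDl, mulmxDr, mulNmx, mulmxN) !opprD ?opprK !addrA.
congr block_mx.
- by rewrite (ACl (1*9*(2*7)*(3*6)*(4*12)*(5*11)*(10*8)))/= !subrr !addr0.
- by rewrite subrK.
- by rewrite (ACl (1*3*(2*4)))/= subrr addr0.
- by rewrite (ACl (10*4*(1*11)*(2*8)*(3*6)*(9*5)*(7*12)))/= !subrr !addr0.
Qed.

(* Strassen's algorithm on matrices of size [2 ^ d], down to scalars: the
   product, and the list of the [7 ^ d] scalar multiplications performed. *)
Fixpoint strassen (d : nat) : 'M[R]_(pow2 d) -> 'M[R]_(pow2 d) ->
    'M[R]_(pow2 d) * seq (R * R) :=
  match d with
  | 0 => fun A B => ((A ord0 ord0 * B ord0 ord0)%:M, [:: (A ord0 ord0, B ord0 ord0)])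
  | d.+1 => fun A B =>
      let rec := [seq strassen ST.1 ST.2 | ST <- strassen_operands A B] in
      (strassen_combine (unzip1 rec), flatten (unzip2 rec))
  end.

Lemma strassen_product d (A B : 'M[R]_(pow2 d)) : (strassen A B).1 = A *m B.
Proof.
elim: d A B => [|d IH] A B.
  by apply/matrixP=> i j; rewrite !mxE big_ord1 !ord1 eqxx mulr1n.
by rewrite /= -strassen_combineE /= !IH.
Qed.

End Strassen.

(* Padding with zeros; only used when [n <= 2 ^ d]. *)
Definition pad (R : pzRingType) (d n : nat) (A : 'M[R]_n) : 'M[R]_(pow2 d) :=
  \matrix_(i, j)
    match insub (val i) : option 'I_n, insub (val j) : option 'I_n with
    | Some i', Some j' => A i' j'
    | _, _ => 0%R
    end.

(* The scalar multiplications of Strassen's algorithm on [n] x [n] matrices,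
   padded to the smallest power of two. *)
Definition strassen_mults (R : pzRingType) (n : nat) (A B : 'M[R]_n) : seq (R * R) :=
  (strassen (pad (up_log 2 n) A) (pad (up_log 2 n) B)).2.

Definition log2 (K : realType) (x : K) : K := (ln x / ln 2)%R.

(* Main.v *)
Require Import Defs.
From mathcomp Require Import all_boot all_order all_algebra.
From mathcomp Require Import reals exp.
From mathcomp Require Import zify lra.
Import Order.TTheory GRing.Theory Num.Theory.
Local Open Scope ring_scope.

(** A product of size [2 ^ d] is reduced to [7 ^ k] products of size
    [2 ^ (d - k)] by unrolling [k] levels of Strassen's recursion at once: every
    entry of the operands, and afterwards of the result, is computed on its own
    by a fork tree that follows the [k] digits of the recursion path and has at
    most 4 leaves per level. This takes span [O(d)] and work and space
    [O(7 ^ k * 4 ^ d)], which is [O(6 ^ d)] for [k = ceil (d / 5)] because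
    [7 * 4 ^ 5 < 6 ^ 5]. As [d - k <= 4 * d / 5], the spans add up to [O(d)], and
    as [6 < 7], the work to [O(7 ^ d)].

    The [7 ^ k] subproducts run in parallel if [d > cut] and one after the other
    otherwise, where [7 ^ cut] is of order [log n]. A serial product has span at
    most its work [O(7 ^ cut)], and needs space [O(6 ^ d)] only, which is the
    fraction [(6 / 7) ^ d] of [7 ^ d]; recursion becomes serial at some
    [d >= 4 * cut / 5], so the total space is
    [O(7 ^ log n * (6 / 7) ^ (4 * cut / 5))], and [(7 / 6) ^ x] exceeds [1 + x / 6]
    while [cut] is of order [log (log n)]. *)
Set Implicit Arguments.
Unset Strict Implicit.
Unset Printing Implicit Defensive.
Local Open Scope nat_scope.

(** * Bounded executions *)

(** Level by level, the matrix additions of Strassen's recursion would cost a logarithmic span on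
    each of [log n] levels. Unrolling a fixed fraction of the levels shrinks [d] geometrically, at
    the price of recomputing each operand entry on its own. The fraction is one fifth because 5 is
    the least [q] with [7 * 4 ^ q < 6 ^ q]; the base 6 must lie strictly below 7 so that the
    overheads of all rounds are absorbed by [7 ^ d]. The cutoff is placed where the whole work of a
    serial product is already [O(log n)], so serial products need no span analysis of their own:
    [dag_span_le_work] suffices. The resulting span is [O(log n)], and the factor [log log log n]
    enters only as a number that is at least 1. On the formal side, [exec] threads one heap through
    both branches of [Par]. Commands are therefore specified by the cells that they overwrite, the
    final values and a footprint, starting from any heap that agrees with a reference heap on the
    cells that matter; race freedom then follows from disjointness of footprints. *)

Lemma dag_span_le_work (R : pzRingType) (t : dag R) : dag_span t <= dag_work t.
Proof. by elim: t => //= *; lia. Qed.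

(** A total evaluator. Paired with [safe] it replaces the option-valued [eval], so that the absence
    of overflow becomes a conjunction of inequalities. *)
Fixpoint den (env : seq nat) (e : expr) : nat :=
  match e with
  | Var x => nth 0 env x
  | Cst v => v
  | Bin o e1 e2 => wop_fun o (den env e1) (den env e2)
  end.

Fixpoint safe (w : nat) (env : seq nat) (e : expr) : bool :=
  match e with
  | Var x => x < size env
  | Cst v => v < w
  | Bin o e1 e2 => [&& safe w env e1, safe w env e2 &
                       wop_fun o (den env e1) (den env e2) < w]
  end.

Lemma onth_some (T : Type) (x0 : T) s i :
  i < size s -> onth s i = Some (nth x0 s i).
Proof. by elim: s i => [|x s IH] [|i] //= /IH. Qed.

Lemma safe_eval w env e : safe w env e -> eval w env e = Some (den env e).
Proof.
elim: e => [x|v|o e1 IH1 e2 IH2] /=; first exact: onth_some.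
  by rewrite /word_check => ->.
by case/and3P=> /IH1-> /IH2-> lt_w; rewrite /word_check lt_w.
Qed.

Definition csafe w env (aenv : seq nat) (c : cell) : bool :=
  let: Cell x e := c in (x < size aenv) && safe w env e.

Definition cden env (aenv : seq nat) (c : cell) : loc :=
  let: Cell x e := c in (nth 0 aenv x, den env e).

Lemma csafe_locate w env aenv c :
  csafe w env aenv c -> locate w env aenv c = Some (cden env aenv c).
Proof.
by case: c => x e /= /andP[/(onth_some 0)-> /safe_eval->].
Qed.

(** * Heaps described by their shape and their loads *)

Section Heap.
Variable R : pzRingType.
Implicit Types (h : heap R) (l : loc) (u : loc -> option R).

Lemma validE h l : valid h l = (l.2 < nth 0 (shape h) l.1).
Proof.
rewrite /valid /shape; case: (ltnP l.1 (size h)) => [lt_l|ge_l].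
  by rewrite (nth_map [::]).
by rewrite !nth_default // size_map.
Qed.

Lemma load_valid h l x : load h l = Some x -> valid h l.
Proof.
by rewrite /load /valid; case: (ltnP l.2) => // ge_l; rewrite nth_default.
Qed.

Lemma valid_size h l : valid h l -> l.1 < size h.
Proof.
by rewrite /valid; case: (ltnP l.1 (size h)) => // ge_l; rewrite nth_default.
Qed.

Lemma shape_size h h' : shape h' = shape h -> size h' = size h.
Proof. by move=> /(congr1 size); rewrite !size_map. Qed.

Lemma store_shape h l v : valid h l -> shape (store h l v) = shape h.
Proof.
move=> vl; have lt1 := valid_size vl.
apply: (@eq_from_nth _ 0).
  by rewrite !size_map size_set_nth; apply/maxn_idPr.
move=> i; rewrite size_map size_set_nth (maxn_idPr lt1) => lti.
rewrite !(nth_map [::]) ?size_set_nth ?(maxn_idPr lt1) //.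
rewrite nth_set_nth /=; case: eqP => // ->.
by rewrite size_set_nth; apply/maxn_idPr.
Qed.

Lemma load_store h l v l' :
  load (store h l v) l' = if l' == l then Some v else load h l'.
Proof.
case: l l' => b o [b' o']; rewrite /load /store nth_set_nth /= xpair_eqE.
by case: eqP => //= ->; rewrite nth_set_nth /=; case: eqP.
Qed.

(** Uninitialized cells and cells of missing blocks both load [None], so an allocation is invisible
    to [load] and is recorded by [shape] alone. *)
Lemma load_rcons h k : load (rcons h (nseq k None)) =1 load h.
Proof.
move=> l; rewrite /load nth_rcons; case: ltngtP => // [ltl|->].
  by rewrite [nth _ h _]nth_default // ltnW.
by rewrite [nth _ h _]nth_default // nth_nseq nth_nil; case: ifP.
Qed.

Lemma shape_rcons h k : shape (rcons h (nseq k None)) = rcons (shape h) k.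
Proof. by rewrite /shape map_rcons size_nseq. Qed.

Lemma load_take h m l : load (take m h) l = if l.1 < m then load h l else None.
Proof.
rewrite /load; case: ltnP => lm; first by rewrite nth_take.
rewrite [nth _ (take _ _) _]nth_default ?nth_nil //.
by rewrite size_take_min (leq_trans _ lm) ?geq_minl.
Qed.

Lemma heap_ext h1 h2 : shape h1 = shape h2 -> load h1 =1 load h2 -> h1 = h2.
Proof.
move=> es el; apply: (@eq_from_nth _ [::]) => [|i lti].
  exact: shape_size es.
have ej : size (nth [::] h1 i) = size (nth [::] h2 i).
  move: (congr1 (nth 0 ^~ i) es).
  by rewrite !(nth_map [::]) -?(shape_size es).
by apply: (@eq_from_nth _ None) => // j _; apply: (el (i, j)).
Qed.

(* An update [u : loc -> option R] maps the overwritten cells to their final values. *)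
Definition ovr u (f : loc -> option R) : loc -> option R :=
  fun l => if u l is Some v then Some v else f l.

Definition cell_upd l0 v : loc -> option R :=
  fun l => if l == l0 then Some v else None.

(** * Proof rules for the commands *)

Section Runs.
Variables (P : seq cmd) (w : nat).

(* [rd] bounds the cells read besides those in [u]; [wk], [sp] and [sc] bound
   work, span and space. *)
Definition runs env aenv h c u (rd : pred loc) (ms : seq (R * R))
    (wk sp sc : nat) : Prop :=
  exists h' t,
    [/\ exec P w env aenv h c h' t, shape h' = shape h,
        forall l, load h' l = ovr u (load h) l &
        [/\ race_free t, {in written t, forall l, u l},
            {in touched t, forall l, u l || rd l}, mults t = ms &
            [/\ dag_work t <= wk, dag_span t <= sp & dag_space t <= sc]]].

Implicit Types (env aenv : seq nat) (c : cmd) (rd : pred loc).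

Lemma runs_weaken env aenv h c u rd ms wk sp sc u' rd' wk' sp' sc' :
    runs env aenv h c u' rd' ms wk' sp' sc' ->
    u' =1 u -> (forall l, rd' l -> u l || rd l) ->
    wk' <= wk -> sp' <= sp -> sc' <= sc ->
  runs env aenv h c u rd ms wk sp sc.
Proof.
case=> h' [t [ex sh ld [rf wr to mu [cw cs cc]]]] eu erd lw ls lc.
exists h', t; split=> //; first by move=> l; rewrite ld /ovr eu.
split=> //; first by move=> l /wr; rewrite eu.
  by move=> l /to; rewrite eu => /orP[->//|/erd].
by split; [apply: leq_trans lw | apply: leq_trans ls | apply: leq_trans lc].
Qed.

Lemma runs_le env aenv h c u rd ms wk sp sc wk' sp' sc' :
    runs env aenv h c u rd ms wk' sp' sc' ->
    wk' <= wk -> sp' <= sp -> sc' <= sc ->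
  runs env aenv h c u rd ms wk sp sc.
Proof.
by move=> H *; apply: runs_weaken H _ _ _ _ _ => // l ->; rewrite orbT.
Qed.

(** This rule bounds the span of serial products, for which adding up the spans of the iterations
    would be too coarse. *)
Lemma runs_span_work env aenv h c u rd ms wk sp sc :
  runs env aenv h c u rd ms wk sp sc ->
  runs env aenv h c u rd ms wk (minn sp wk) sc.
Proof.
case=> h' [t [ex sh ld [rf wr to mu [cw cs cc]]]]; exists h', t; split=> //.
by split=> //; split=> //; rewrite leq_min cs (leq_trans (dag_span_le_work t)).
Qed.

Lemma runs_seq env aenv h c1 c2 u1 u2 rd ms1 ms2 wk1 wk2 sp1 sp2 sc :
    runs env aenv h c1 u1 rd ms1 wk1 sp1 sc ->
    (forall h1, shape h1 = shape h -> load h1 =1 ovr u1 (load h) ->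
       runs env aenv h1 c2 u2 (fun l => rd l || u1 l) ms2 wk2 sp2 sc) ->
  runs env aenv h (Seq c1 c2) (ovr u2 u1) rd (ms1 ++ ms2)
       (wk1 + wk2) (sp1 + sp2) sc.
Proof.
case=> h1 [t1 [ex1 sh1 ld1 [rf1 wr1 to1 mu1 [cw1 cs1 cc1]]]].
case/(_ h1 sh1 ld1)=> h2 [t2 [ex2 sh2 ld2 [rf2 wr2 to2 mu2 [cw2 cs2 cc2]]]].
exists h2, (Ser t1 t2); split; first exact: exec_seq ex1 ex2.
- by rewrite sh2.
- by move=> l; rewrite ld2 /ovr ld1 /ovr; case: (u2 l).
split=> /=; first by rewrite rf1.
- move=> l; rewrite mem_cat /ovr => /orP[/wr1|/wr2]; by case: (u2 l).
- move=> l; rewrite mem_cat /ovr => /orP[/to1|/to2]; case: (u2 l) => //=.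
  by rewrite orbC.
- by rewrite mu1 mu2.
by split; rewrite ?leq_add // geq_max cc1.
Qed.

(** The second branch is specified from the heap left by the first one, as in [exec_par]. The three
    disjointness conditions (write/write and both write/read pairs) are what [race_free] checks at
    the fork. *)
Lemma runs_par env aenv h c1 c2 u1 u2 rd1 rd2 rd ms1 ms2 wk1 wk2 sp sc1 sc2 :
    runs env aenv h c1 u1 rd1 ms1 wk1 sp sc1 ->
    (forall h1, shape h1 = shape h -> load h1 =1 ovr u1 (load h) ->
       runs env aenv h1 c2 u2 rd2 ms2 wk2 sp sc2) ->
    (forall l, u1 l -> ~~ u2 l) -> (forall l, u1 l -> ~~ rd2 l) ->
    (forall l, u2 l -> ~~ rd1 l) -> (forall l, rd1 l || rd2 l -> rd l) ->
  runs env aenv h (Par c1 c2) (ovr u2 u1) rd (ms1 ++ ms2)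
       (wk1 + wk2).+2 sp.+2 (sc1 + sc2).
Proof.
case=> h1 [t1 [ex1 sh1 ld1 [rf1 wr1 to1 mu1 [cw1 cs1 cc1]]]] H2 d12 d1 d2 drd.
case/(_ h1 sh1 ld1): H2 => h2 [t2 [ex2 sh2 ld2 [rf2 wr2 to2 mu2 [cw2 cs2 cc2]]]].
exists h2, (Fork t1 t2); split; first exact: exec_par ex1 ex2.
- by rewrite sh2.
- by move=> l; rewrite ld2 /ovr ld1 /ovr; case: (u2 l).
split=> /=.
- rewrite rf1 rf2 /=; apply/andP; split; apply/hasPn=> l /[dup].
    move=> /wr1 u1l _; apply/negP => /to2.
    by rewrite (negPf (d12 _ u1l)) (negPf (d1 _ u1l)).
  move=> /wr2 u2l _; apply/negP => /to1; rewrite (negPf (d2 _ u2l)) orbF.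
  by move=> u1l; rewrite (negPf (d12 _ u1l)) in u2l.
- move=> l; rewrite mem_cat /ovr => /orP[/wr1|/wr2]; by case: (u2 l).
- move=> l; rewrite mem_cat /ovr => /orP[/to1|/to2]; case: (u2 l) => //=.
    by case/orP=> [->//|r1]; rewrite drd ?orbT // r1.
  by move=> r2; rewrite drd ?orbT // r2 orbT.
- by rewrite mu1 mu2.
by split; rewrite ?ltnS ?leq_add // geq_max cs1.
Qed.

Lemma runs_let env aenv h e c u rd ms wk sp sc :
    safe w env e -> cost e <= wk -> cost e <= sp ->
    runs (den env e :: env) aenv h c u rd ms (wk - cost e) (sp - cost e) sc ->
  runs env aenv h (Let e c) u rd ms wk sp sc.
Proof.
move=> se lw ls [h' [t [ex sh ld [rf wr to mu [cw cs cc]]]]].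
exists h', (Ser (Local (cost e)) t); split=> //.
  by apply: exec_let ex; apply: safe_eval.
by split=> //=; split; rewrite ?max0n //; lia.
Qed.

Lemma runs_if env aenv h e1 e2 c1 c2 u rd ms wk sp sc :
    safe w env e1 -> safe w env e2 ->
    cost e1 + cost e2 < wk -> cost e1 + cost e2 < sp ->
    runs env aenv h (if den env e1 <= den env e2 then c1 else c2) u rd ms
         (wk - (cost e1 + cost e2).+1) (sp - (cost e1 + cost e2).+1) sc ->
  runs env aenv h (IfLe e1 e2 c1 c2) u rd ms wk sp sc.
Proof.
move=> s1 s2 lw ls [h' [t [ex sh ld [rf wr to mu [cw cs cc]]]]].
exists h', (Ser (Local (cost e1 + cost e2).+1) t); split=> //.
  by apply: exec_if ex; apply: safe_eval.
by split=> //=; split; rewrite ?max0n //; lia.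
Qed.

Lemma runs_call env aenv h p es xs c u rd ms wk sp sc :
    onth P p = Some c -> all (safe w env) es ->
    all (fun x => x < size aenv) xs ->
    costs es + size xs < wk -> costs es + size xs < sp ->
    runs (map (den env) es) (map (nth 0 aenv) xs) h c u rd ms
         (wk - (costs es + size xs).+1) (sp - (costs es + size xs).+1) sc ->
  runs env aenv h (Call p es xs) u rd ms wk sp sc.
Proof.
move=> pc ses sxs lw ls [h' [t [ex sh ld [rf wr to mu [cw cs cc]]]]].
exists h', (Ser (Local (costs es + size xs).+1) t); split=> //.
  apply: exec_call pc _ _ ex; rewrite -map_comp.
    by elim: es ses {lw ls cw cs} => //= e es IH /andP[/safe_eval-> /IH->].
  by elim: xs sxs {lw ls cw cs} => //= x xs IH /andP[/(onth_some 0)-> /IH->].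
by split=> //=; split; rewrite ?max0n //; lia.
Qed.

Lemma runs_call_add K env aenv h p es xs c u rd ms wk sp sc :
    onth P p = Some c -> all (safe w env) es -> all (fun x => x < size aenv) xs ->
    costs es + size xs < K ->
    runs (map (den env) es) (map (nth 0 aenv) xs) h c u rd ms wk sp sc ->
  runs env aenv h (Call p es xs) u rd ms (wk + K) (sp + K) sc.
Proof.
move=> Pp ses sxs lK H; apply: (runs_call Pp ses sxs); try lia.
by apply: runs_le H _ _ _ => //; lia.
Qed.

Lemma runs_new env aenv h e c u rd rd' v ms wk sp sc :
    safe w env e -> (cost e).+2 <= wk -> (cost e).+2 <= sp -> den env e <= sc ->
    (forall h1, shape h1 = rcons (shape h) (den env e) -> load h1 =1 load h ->
      runs env (size h :: aenv) h1 c v rd' ms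
         (wk - (cost e).+2) (sp - (cost e).+2) (sc - den env e)) ->
    (forall l, l.1 != size h -> v l = u l) ->
    (forall l, l.1 = size h -> u l = None) ->
    (forall l, l.1 != size h -> rd' l -> u l || rd l) ->
  runs env aenv h (New e c) u rd ms wk sp sc.
Proof.
move=> se lw ls lc H uv u0 rd_rd'.
case: (H _ (shape_rcons h (den env e)) (load_rcons h (den env e))).
move=> h' [t [ex sh ld [rf wr to mu [cw cs cc]]]].
have szh' : size h' = (size h).+1 by rewrite (shape_size sh) size_rcons.
exists (take (size h) h'), (Ser (Local (cost e)) (Heap (size h) (den env e) t)).
split.
- by apply: exec_new ex; apply: safe_eval.
- by rewrite /shape map_take -/(shape h') sh shape_rcons -cats1 take_size_cat ?size_map.
- move=> l; rewrite load_take ld /ovr; case: ltnP => ltl.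
    by rewrite uv ?load_rcons // neq_ltn ltl.
  have hN : load h l = None by rewrite /load [nth _ h _]nth_default ?nth_nil.
  rewrite hN; case: (l.1 =P size h) => [/u0->//|/eqP nel].
  (* A block beyond the fresh one cannot be updated: a successful load from [h'] would make the
     location valid, but [h'] has only [(size h).+1] blocks. *)
  rewrite -uv //; case El: (v l) => [x|//].
  have : load h' l = Some x by rewrite ld /ovr El.
  by move=> /load_valid/valid_size; rewrite szh'; lia.
split=> //=.
- by move=> l; rewrite mem_filter => /andP[nel /wr]; rewrite uv.
- move=> l; rewrite mem_filter => /andP[nel /to]; rewrite uv //.
  by case/orP=> [->//|/rd_rd'->].
by split; rewrite ?max0n; lia.
Qed.

Lemma runs_zero env aenv h d l0 rd wk sp sc :
    csafe w env aenv d -> cden env aenv d = l0 -> valid h l0 ->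
    ccost d < wk -> ccost d < sp ->
  runs env aenv h (Zero d) (cell_upd l0 0%R) rd [::] wk sp sc.
Proof.
move=> sd <- vd lw ls; exists (store h (cden env aenv d) 0%R),
  (Ser (Local (ccost d)) (Access [::] [:: cden env aenv d] [::])); split.
- by apply: exec_zero => //; apply: csafe_locate.
- exact: store_shape.
- by move=> l; rewrite load_store /ovr /cell_upd; case: eqP.
split=> //=; try by split; rewrite ?maxnn //; lia.
  by move=> l; rewrite inE /cell_upd => ->.
by move=> l; rewrite inE /cell_upd => ->.
Qed.

Lemma runs_move env aenv h d a l0 x rd wk sp sc :
    csafe w env aenv d -> cden env aenv d = l0 -> valid h l0 ->
    csafe w env aenv a -> load h (cden env aenv a) = Some x ->
    rd (cden env aenv a) ->
    ccost d + ccost a < wk -> ccost d + ccost a < sp ->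
  runs env aenv h (Move d a) (cell_upd l0 x) rd [::] wk sp sc.
Proof.
move=> sd <- vd sa la ra lw ls; exists (store h (cden env aenv d) x),
  (Ser (Local (ccost d + ccost a))
     (Access [:: cden env aenv a] [:: cden env aenv d] [::])); split.
- by apply: exec_move la => //; apply: csafe_locate.
- exact: store_shape.
- by move=> l; rewrite load_store /ovr /cell_upd; case: eqP.
split=> //=; try by split; rewrite ?maxnn //; lia.
  by move=> l; rewrite inE /cell_upd => ->.
by move=> l; rewrite !inE /cell_upd => /orP[/eqP->|->]; rewrite ?ra ?orbT.
Qed.

Lemma runs_arith env aenv h o d a b l0 x y rd wk sp sc :
    csafe w env aenv d -> cden env aenv d = l0 -> valid h l0 ->
    csafe w env aenv a -> load h (cden env aenv a) = Some x ->
    csafe w env aenv b -> load h (cden env aenv b) = Some y ->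
    rd (cden env aenv a) -> rd (cden env aenv b) ->
    ccost d + ccost a + ccost b < wk -> ccost d + ccost a + ccost b < sp ->
  runs env aenv h (Arith o d a b) (cell_upd l0 (rop_fun o x y)) rd
       (rop_mults o x y) wk sp sc.
Proof.
move=> sd <- vd sa la sb lb ra rb lw ls.
exists (store h (cden env aenv d) (rop_fun o x y)),
  (Ser (Local (ccost d + ccost a + ccost b))
     (Access [:: cden env aenv a; cden env aenv b] [:: cden env aenv d]
        (rop_mults o x y))); split.
- by apply: exec_arith la _ lb => //; apply: csafe_locate.
- exact: store_shape.
- by move=> l; rewrite load_store /ovr /cell_upd; case: eqP.
split=> //=; try by split; rewrite ?maxnn //; lia.
  by move=> l; rewrite inE /cell_upd => ->.
by move=> l; rewrite !inE /cell_upd => /or3P[/eqP->|/eqP->|->];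
  rewrite ?ra ?rb ?orbT.
Qed.

End Runs.
End Heap.

(** * Parallel and serial loops *)

(* The body sees the loop index as word 0, the (then useless) length 1 as
   word 1, and the [np] parameters behind. *)
Definition loop (cmb : cmd -> cmd -> cmd) (p np na : nat) (body : cmd) : cmd :=
  let ps := map Var (iota 3 np) in
  IfLe (Var 1) (Cst 1) body
    (Let (Bin WDiv (Var 1) (Cst 2))
       (cmb (Call p (Var 1 :: Var 0 :: ps) (iota 0 na))
            (Call p (Bin WAdd (Var 1) (Var 0) :: Bin WSub (Var 2) (Var 0) :: ps)
               (iota 0 na)))).

(* [own l] is the only iteration that may write cell [l]. *)
Definition restrict (R : pzRingType) (own : loc -> nat) (uu : loc -> option R)
    (lo len : nat) : loc -> option R :=
  fun l => if lo <= own l < lo + len then uu l else None.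

Section Loop.
Variables (R : pzRingType) (P : seq cmd) (w : nat).
Implicit Types (h : heap R) (rd : pred loc).
Variables (p : nat) (body : cmd) (ps bs : seq nat).
Variables (own : loc -> nat) (uu : loc -> option R) (rd : pred loc).
Variables (h0 : heap R) (ms : nat -> seq (R * R)) (wk sp sc lo0 hi0 : nat).

Hypothesis rd_uu : forall l, rd l -> uu l = None.
Hypothesis w2 : 2 < w.
Hypothesis hi0w : hi0 < w.
(** The starting heap is arbitrary on the cells of [uu], because other iterations may already have
    overwritten some of them. *)
Hypothesis run_body : forall i h, lo0 <= i < hi0 -> shape h = shape h0 ->
  (forall l, uu l = None -> load h l = load h0 l) ->
  runs P w (i :: 1 :: ps) bs h body (restrict own uu i 1) rd (ms i) wk sp sc.

(** Bounds the overhead of one node of the splitting tree. The bound [len * (wk + 2 * c) - c] is an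
    amortization: the two halves together leave [2 * c] unspent, of which one [c] pays for the node
    and the other is handed on. *)
Let c := 2 * (size ps + size bs) + 40.

Lemma restrict_split lo n1 n2 :
  ovr (restrict own uu (lo + n1) n2) (restrict own uu lo n1)
    =1 restrict own uu lo (n1 + n2).
Proof.
move=> l; rewrite /ovr /restrict.
case: (boolP (lo + n1 <= own l < lo + n1 + n2)) => h2.
  have -> : lo <= own l < lo + (n1 + n2) by lia.
  have -> : lo <= own l < lo + n1 = false by lia.
  by case: (uu l).
by congr (if _ then _ else _); lia.
Qed.

Lemma costs_vars m n : costs (map Var (iota m n)) = n.
Proof. by rewrite /costs; elim: n m => //= n IH m; rewrite IH. Qed.

Lemma safe_vars env m n : m + n <= size env -> all (safe w env) (map Var (iota m n)).
Proof. by elim: n m => //= n IH m le; rewrite IH; lia. Qed.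

Lemma den_params (a b d : nat) :
  map (den [:: a, b, d & ps]) (map Var (iota 3 (size ps))) = ps.
Proof.
rewrite -map_comp (iotaDl 3 0) -map_comp.
rewrite (eq_map (g := nth 0 ps)) //.
by rewrite map_nth_iota0 // take_size.
Qed.

Lemma arrays_id : map (nth 0 bs) (iota 0 (size bs)) = bs.
Proof. by rewrite map_nth_iota0 // take_size. Qed.

Lemma safe_arrays : all (fun x => x < size bs) (iota 0 (size bs)).
Proof. by apply/allP=> x; rewrite mem_iota. Qed.

Definition loop_span (par : bool) e len :=
  if par then sp + c * e.+1 else len * (sp + 2 * c) - c.

Definition loop_space (par : bool) len := if par then len * sc else sc.

Lemma loop_span_ge par e len : 0 < len -> c <= loop_span par e len.
Proof.
rewrite /loop_span => len0; case: par; rewrite ?mulnS; first by lia.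
by have := leq_pmull (sp + 2 * c) len0; lia.
Qed.

Lemma runs_loop1 par e lo h : lo0 <= lo -> lo + 1 <= hi0 -> shape h = shape h0 ->
    (forall l, uu l = None -> load h l = load h0 l) ->
  runs P w (lo :: 1 :: ps) bs h
    (loop (if par then Par else Seq) p (size ps) (size bs) body)
    (restrict own uu lo 1) rd (flatten (map ms (iota lo 1)))
    (1 * (wk + 2 * c) - c) (loop_span par e 1) (loop_space par 1).
Proof.
move=> lo_lo hi_hi shh ldh.
have sp1 : sp + c <= loop_span par e 1.
  by rewrite /loop_span mulnS; case: (par); lia.
have sc1 : loop_space par 1 = sc by rewrite /loop_space mul1n; case: (par).
apply: runs_if => //=; try lia.
rewrite cats0; apply: runs_weaken (run_body _ shh ldh) _ _ _ _ _ => //; try lia.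
Qed.

Lemma runs_loop par e lo len h :
    let lp := loop (if par then Par else Seq) p (size ps) (size bs) body in
    onth P p = Some lp ->
    lo0 <= lo -> lo + len <= hi0 -> 0 < len <= 2 ^ e -> shape h = shape h0 ->
    (forall l, uu l = None -> load h l = load h0 l) ->
  runs P w (lo :: len :: ps) bs h lp
    (restrict own uu lo len) rd (flatten (map ms (iota lo len)))
    (len * (wk + 2 * c) - c) (loop_span par e len) (loop_space par len).
Proof.
move=> lp Pp; elim: e lo len h => [|e IH] lo len h lo_lo hi_hi len_e shh ldh.
  have -> : len = 1 by lia.
  by apply: runs_loop1 => //; lia.
case: (leqP len 1) => [len1|len1].
  have -> : len = 1 by lia.
  by apply: runs_loop1 => //; lia.
have eE : 2 ^ e.+1 = 2 ^ e * 2 by rewrite expnSr.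
set n1 := len %/ 2; set n2 := len - n1.
have lenE : len = n1 + n2 by lia.
have n1_0 : 0 < n1 by lia.
have n2_0 : 0 < n2 by lia.
have bW x : len * x = n1 * x + n2 * x by rewrite -mulnDl -lenE.
have bM n x : 0 < n -> 2 * c + x <= n * (x + 2 * c).
  by move=> n0; rewrite addnC leq_pmull.
have bS : c * e.+2 = c + c * e.+1 by rewrite mulnS.
pose ov := 10 + size ps + size bs.
(* The two recursive calls differ only in their first two words, so one statement covers both. *)
have run_call es lo' n' h' : 0 < n' -> n' <= 2 ^ e ->
    lo0 <= lo' -> lo' + n' <= hi0 ->
    shape h' = shape h0 -> (forall l, uu l = None -> load h' l = load h0 l) ->
    all (safe w [:: n1, lo, len & ps]) es ->
    map (den [:: n1, lo, len & ps]) es = [:: lo'; n'] -> costs es <= 6 ->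
    runs P w [:: n1, lo, len & ps] bs h'
      (Call p (es ++ map Var (iota 3 (size ps))) (iota 0 (size bs)))
      (restrict own uu lo' n') rd (flatten (map ms (iota lo' n')))
      (n' * (wk + 2 * c) - c + ov) (loop_span par e n' + ov)
      (loop_space par n').
  move=> n'0 n'e lo'0 hi' sh' ld' ses des ces.
  have cE : costs (es ++ map Var (iota 3 (size ps))) <= 6 + size ps.
    rewrite /costs map_cat sumn_cat -![sumn _]/(costs _) costs_vars.
    by rewrite leq_add2r.
  apply: (runs_call Pp); rewrite ?size_iota ?safe_arrays //; try lia.
    by rewrite all_cat ses safe_vars //=; lia.
  rewrite map_cat des arrays_id den_params /=.
  apply: runs_weaken (IH _ _ _ _ _ _ _ _) _ _ _ _ _ => //; try lia.
have bW' := bW (wk + 2 * c); have bW1 := bM n1 wk n1_0; have bW2 := bM n2 wk n2_0.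
have bS' := bW (sp + 2 * c); have bS1 := bM n1 sp n1_0; have bS2 := bM n2 sp n2_0.
have lsp := loop_span_ge par e.+1 (proj1 (andP len_e)).
apply: runs_if => /=; try lia.
have -> : (len <= 1) = false by lia.
apply: runs_let => /=; try lia.
have s1 : all (safe w [:: n1, lo, len & ps]) [:: Var 1; Var 0] by [].
have s2 : all (safe w [:: n1, lo, len & ps])
            [:: Bin WAdd (Var 1) (Var 0); Bin WSub (Var 2) (Var 0)].
  by rewrite /=; lia.
have r1 := fun a1 a2 a3 => run_call _ lo n1 h n1_0 a1 a2 a3 shh ldh s1 erefl isT.
have r2 h1 sh1 ld1 := fun a1 a2 a3 =>
  run_call _ (lo + n1) n2 h1 n2_0 a1 a2 a3 (etrans sh1 shh) ld1 s2 erefl isT.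
have {}r1 := r1 ltac:(lia) ltac:(lia) ltac:(lia).
have {}r2 h1 sh1 ld1 := r2 h1 sh1 ld1 ltac:(lia) ltac:(lia) ltac:(lia).
have -> : iota lo len = iota lo n1 ++ iota (lo + n1) n2 by rewrite -iotaD -lenE.
rewrite map_cat flatten_cat.
have ur lo' n' l : restrict own uu lo' n' l -> ~~ rd l.
  rewrite /restrict; case: ifP => // _ ul; apply/negP => /rd_uu.
  by move=> e0; rewrite e0 in ul.
have ld1' h1 : load h1 =1 ovr (restrict own uu lo n1) (load h) ->
    forall l, uu l = None -> load h1 l = load h0 l.
  by move=> ld1 l ul; rewrite ld1 /ovr /restrict ul; case: ifP => _; apply: ldh.
case: par @lp Pp IH run_call r1 r2 lsp => lp Pp IH run_call r1 r2 lsp.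
  apply: runs_weaken (runs_par (rd := rd) r1
    (fun h1 sh1 ld1 => r2 h1 sh1 (ld1' _ ld1)) _ _ _ _)
    _ _ _ _ _; rewrite //= /loop_span /loop_space /=; try lia.
  - by move=> l; rewrite /restrict; do 2!case: ifP => //; lia.
  - exact: ur.
  - exact: ur.
  - by move=> l; rewrite restrict_split -lenE.
have {r2} r2' h1 (sh1 : shape h1 = shape h)
    (ld1 : load h1 =1 ovr (restrict own uu lo n1) (load h)) :
    runs P w [:: n1, lo, len & ps] bs h1
      (Call p ([:: Bin WAdd (Var 1) (Var 0); Bin WSub (Var 2) (Var 0)] ++
         map Var (iota 3 (size ps))) (iota 0 (size bs)))
      (restrict own uu (lo + n1) n2) (fun l => rd l || restrict own uu lo n1 l)
      (flatten (map ms (iota (lo + n1) n2)))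
      (n2 * (wk + 2 * c) - c + ov) (loop_span false e n2 + ov) sc.
  by apply: runs_weaken (r2 _ sh1 (ld1' _ ld1)) _ _ _ _ _ => // l ->; rewrite orbT.
apply: runs_weaken (runs_seq r1 r2') _ _ _ _ _;
  rewrite //= /loop_span /loop_space /=; try lia.
by move=> l; rewrite restrict_split -lenE.
Qed.

End Loop.

Definition block_upd (R : Type) b off len (v : nat -> R) : loc -> option R :=
  fun l => if (l.1 == b) && (off <= l.2 < off + len) then Some (v (l.2 - off))
           else None.

Definition loop_overhead (nps nbs : nat) := 2 * (nps + nbs) + 40.

(** Ownership is given by division: cell [off + o] belongs to iteration [o %/ q]. Loops over single
    entries take [q = 1], the loop over subproducts takes [q = m * m]. *)
Lemma runs_block_loop (R : pzRingType) P w p par body ps bs (h0 : heap R) (b off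
    N q : nat) (v : nat -> R) (rd : pred loc) ms wk sp sc e :
    onth P p = Some (loop (if par then Par else Seq) p (size ps) (size bs) body) ->
    0 < N <= 2 ^ e -> N < w -> 2 < w -> (forall l, rd l -> l.1 != b) -> 0 < q ->
    (forall i h, i < N -> shape h = shape h0 ->
       (forall l, l.1 != b -> load h l = load h0 l) ->
       runs P w (i :: 1 :: ps) bs h body
         (block_upd b (off + i * q) q (fun o => v (i * q + o))) rd (ms i)
         wk sp sc) ->
  runs P w (0 :: N :: ps) bs h0
    (loop (if par then Par else Seq) p (size ps) (size bs) body)
    (block_upd b off (N * q) v) rd (flatten (map ms (iota 0 N)))
    (N * (wk + 2 * loop_overhead (size ps) (size bs)))
    (if par then sp + loop_overhead (size ps) (size bs) * e.+1
     else N * (sp + 2 * loop_overhead (size ps) (size bs)))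
    (if par then N * sc else sc).
Proof.
move=> Pp Ne Nw w2 rdb q0 run_body.
pose uu := block_upd b off (N * q) v; pose own (l : loc) := (l.2 - off) %/ q.
have rd_uu l : rd l -> uu l = None by move=> /rdb; rewrite /uu /block_upd => /negPf->.
have uuE i : i < N ->
  restrict own uu i 1 =1 block_upd b (off + i * q) q (fun o => v (i * q + o)).
  move=> iN l; rewrite /restrict /uu /block_upd /own.
  case: (l.1 == b); rewrite ?if_same //=.
  have iNq : i * q + q <= N * q by rewrite addnC -mulSn leq_mul2r iN orbT.
  have own_lo : off <= l.2 -> (i <= (l.2 - off) %/ q < i + 1) =
      (off + i * q <= l.2 < off + i * q + q).
    move=> ol; rewrite addn1 ltnS leq_divRL //.
    have -> : ((l.2 - off) %/ q <= i) = (l.2 - off < i.+1 * q).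
      by rewrite -ltn_divLR.
    by rewrite mulSn; lia.
  case: (leqP off l.2) => [ol|lo]; last first.
    by rewrite if_same; case: ifP => //; lia.
  rewrite own_lo //=; case: ifP => // h1.
  rewrite ifT; last by lia.
  by congr (Some (v _)); lia.
have rb i h : 0 <= i < N -> shape h = shape h0 ->
    (forall l, uu l = None -> load h l = load h0 l) ->
    runs P w (i :: 1 :: ps) bs h body (restrict own uu i 1) rd (ms i) wk sp sc.
  move=> /andP[_ iN] sh ld.
  apply: runs_weaken (run_body i h iN sh _) _ _ _ _ _ => //.
  - by move=> l lb; apply: ld; rewrite /uu /block_upd (negPf lb).
  - by move=> l; rewrite uuE.
  by move=> l ->; rewrite orbT.
have H := @runs_loop R P w p body ps bs own uu rd h0 ms wk sp sc 0 N rd_uu w2 Nw rb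
  par e 0 N h0 Pp (leqnn _) (leqnn _) Ne erefl (fun _ _ => erefl).
apply: runs_weaken H _ _ _ _ _.
- move=> l; rewrite /restrict /uu /block_upd /own; case: ifP => // h1.
  case: ifP => // /andP[_ h2].
  have own_N : (l.2 - off) %/ q < N by rewrite ltn_divLR //; lia.
  by rewrite add0n own_N in h1.
- by move=> l ->; rewrite orbT.
- by rewrite leq_subr.
- by rewrite /loop_span; case: par {Pp} => //; rewrite leq_subr.
by [].
Qed.

(** * Linear combinations *)

(** Strassen's coefficients are 0, 1 and -1, and every row has a positive term to start from, so
    sums and differences suffice; [true] marks a difference. *)
Inductive tree := TLeaf of nat | TNode of bool & tree & tree.

Definition pm (R : zmodType) (b : bool) (x y : R) : R :=
  (if b then x - y else x + y)%R.

Fixpoint tree_val (R : zmodType) (v : nat -> R) (t : tree) : R :=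
  match t with
  | TLeaf q => v q
  | TNode b l r => pm b (tree_val v l) (tree_val v r)
  end.

Fixpoint leaves (t : tree) : seq nat :=
  match t with TLeaf q => [:: q] | TNode _ l r => leaves l ++ leaves r end.

(* [leaf q x y e] computes the [q]-th operand from array [x] into cell [e] of
   array [y]. *)
Fixpoint compile (leaf : nat -> nat -> nat -> expr -> cmd) (t : tree) x y e : cmd :=
  match t with
  | TLeaf q => leaf q x y e
  | TNode b l r =>
    New (Cst 2)
      (Seq (Par (compile leaf l x.+1 0 (Cst 0)) (compile leaf r x.+1 0 (Cst 1)))
         (Arith (if b then RSub else RAdd) (Cell y.+1 e)
            (Cell 0 (Cst 0)) (Cell 0 (Cst 1))))
  end.

Section Compile.
Variables (R : pzRingType) (P : seq cmd) (w : nat) (env : seq nat).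
Variables (leaf : nat -> nat -> nat -> expr -> cmd) (b : nat) (v : nat -> R).
Variables (h0 : heap R) (wk sp sc : nat).
Hypothesis w2 : 2 < w.

(* The destination varies, since inner nodes of a tree write to scratch cells. *)
Definition computes_at (c : nat -> nat -> expr -> cmd) (r : R) wk sp sc :=
  forall aenv h x y e bd dof,
    x < size aenv -> y < size aenv -> nth 0 aenv x = b -> nth 0 aenv y = bd ->
    safe w env e -> cost e = 1 -> den env e = dof -> bd != b ->
    valid h (bd, dof) -> b < size h ->
    (forall l, l.1 = b -> load h l = load h0 l) ->
  runs P w env aenv h (c x y e) (cell_upd (bd, dof) r)
    (fun l => l.1 == b) [::] wk sp sc.

(** A tree with [n] leaves has [n - 1] inner nodes, each with two scratch cells and constant
    overhead; hence the subtracted 14 and 2. The span bound charges for all inner nodes instead of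
    the height, which is harmless as trees have at most four leaves. *)
Lemma runs_compile t :
    (forall q, q \in leaves t -> computes_at (leaf q) (v q) wk sp sc) ->
  computes_at (compile leaf t) (tree_val v t)
    (size (leaves t) * (wk + 14) - 14) (size (leaves t) * 14 + sp - 14)
    (size (leaves t) * (sc + 2) - 2).
Proof.
elim: t => [q|s l IHl r IHr] leafH aenv h x y e bd dof.
  move=> *; apply: runs_weaken (leafH q _ aenv h x y e bd dof _ _ _ _ _ _ _ _ _ _ _)
    _ _ _ _ _ => //=; try lia; by rewrite ?inE ?eqxx.
move=> xa ya xb yd se ce de nbd vd bh ld /=.
have sl : 0 < size (leaves l) by elim: (l) => //= *; rewrite size_cat; lia.
have sr : 0 < size (leaves r) by elim: (r) => //= *; rewrite size_cat; lia.
have {}IHl := IHl (fun q ql => leafH q (etrans (mem_cat _ _ _) (introT orP (or_introl ql)))).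
have {}IHr := IHr (fun q ql => leafH q (etrans (mem_cat _ _ _) (introT orP (or_intror ql)))).
rewrite size_cat !mulnDl.
have wl := leq_pmull (wk + 14) sl; have wr := leq_pmull (wk + 14) sr.
have scl := leq_pmull (sc + 2) sl; have scr := leq_pmull (sc + 2) sr.
move: (size (leaves l)) (size (leaves r)) sl sr wl wr scl scr IHl IHr
  => nl nr sl sr wl wr scl scr IHl IHr.
have dh := valid_size vd; rewrite /= in dh.
(* The update inside the allocation also lists the two scratch cells, numbers 0 and 1 of the fresh
   block [size h]; they disappear with the block. *)
apply: (@runs_new R P w env aenv h _ _ _ _ (fun l => l.1 == b)
  (ovr (cell_upd (bd, dof) (pm s (tree_val v l) (tree_val v r)))
     (ovr (cell_upd (size h, 1) (tree_val v r))
        (cell_upd (size h, 0) (tree_val v l))))) => //=; try lia.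
- move=> h1 sh1 ld1.
  have sz1 : size h1 = (size h).+1.
    by rewrite -(size_map size) -/(shape h1) sh1 size_rcons size_map.
  have vT (h2 : heap R) i : shape h2 = shape h1 -> i < 2 -> valid h2 (size h, i).
    by move=> e2 i2; rewrite validE e2 sh1 nth_rcons size_map /= ltnn eqxx.
  have bT : size h != b by rewrite neq_ltn bh orbT.
  have ld1' l0 : l0.1 = b -> load h1 l0 = load h0 l0 by move=> e0; rewrite ld1 ld.
  pose spm := maxn (nl * 14 + sp - 14) (nr * 14 + sp - 14).
  have runL : runs P w env (size h :: aenv) h1 (compile leaf l x.+1 0 (Cst 0))
      (cell_upd (size h, 0) (tree_val v l)) (fun l => l.1 == b) [::]
      (nl * (wk + 14) - 14) spm (nl * (sc + 2) - 2).
    apply: runs_le (leqnn _) _ (leqnn _).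
      apply: IHl => //=; [lia | exact: vT | by rewrite sz1 ltnW].
    exact: leq_maxl.
  have runR (h2 : heap R) : shape h2 = shape h1 ->
      load h2 =1 ovr (cell_upd (size h, 0) (tree_val v l)) (load h1) ->
      runs P w env (size h :: aenv) h2 (compile leaf r x.+1 0 (Cst 1))
      (cell_upd (size h, 1) (tree_val v r)) (fun l => l.1 == b) [::]
      (nr * (wk + 14) - 14) spm (nr * (sc + 2) - 2).
    move=> sh2 ld2; apply: runs_le (leqnn _) _ (leqnn _).
      apply: IHr => //=; [lia | exact: vT | by rewrite (shape_size sh2) sz1 ltnW |].
      move=> l0 l0b; rewrite ld2 /ovr /cell_upd ld1' //.
      by case: eqP => // e0; move: bT; rewrite -l0b e0 eqxx.
    exact: leq_maxr.
  have par := runs_par (rd := fun l => l.1 == b) runL runR.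
  have -> : [::] = ([::] ++ [::]) ++ rop_mults (if s then RSub else RAdd)
      (tree_val v l) (tree_val v r) by case: (s).
  apply: runs_le; [apply: (runs_seq (par _ _ _ _) (wk2 := 8) (sp2 := 8)) | | |].
  + by move=> l0; rewrite /cell_upd; case: eqP => // ->; case: eqP.
  + by move=> l0; rewrite /cell_upd; case: eqP => // ->.
  + by move=> l0; rewrite /cell_upd; case: eqP => // ->.
  + by move=> l0; rewrite orbb.
  + move=> h2 sh2 ld2.
    have -> : pm s (tree_val v l) (tree_val v r) =
        rop_fun (if s then RSub else RAdd) (tree_val v l) (tree_val v r).
      by case: (s).
    apply: runs_arith; rewrite /= ?yd ?de ?ce ?ld2 /ovr /cell_upd ?xpair_eqE ?eqxx ?orbT //;
      try lia.
    by rewrite validE sh2 sh1 nth_rcons size_map dh -validE.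
  + by lia.
  + by rewrite /spm; lia.
  by lia.
- move=> l0 nl0; rewrite /ovr /cell_upd; case: (l0 == (bd, dof)) => //.
  case: (l0 =P (size h, 1)) => [e0|_]; first by rewrite e0 eqxx in nl0.
  by case: (l0 =P (size h, 0)) => [e0|//]; rewrite e0 eqxx in nl0.
- move=> l0 el0; rewrite /cell_upd; case: eqP => // e0.
  by move: dh; rewrite -el0 e0 ltnn.
Qed.

End Compile.

(** * Unrolled recursion *)

(* Rows of Strassen's three coefficient matrices; the quadrant in block row [r]
   and block column [c] has number [2 * r + c]. *)
Definition rowsA : seq tree :=
  [:: TNode false (TLeaf 0) (TLeaf 3); TNode false (TLeaf 2) (TLeaf 3);
      TLeaf 0; TLeaf 3; TNode false (TLeaf 0) (TLeaf 1);
      TNode true (TLeaf 2) (TLeaf 0); TNode true (TLeaf 1) (TLeaf 3)].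

Definition rowsB : seq tree :=
  [:: TNode false (TLeaf 0) (TLeaf 3); TLeaf 0; TNode true (TLeaf 1) (TLeaf 3);
      TNode true (TLeaf 2) (TLeaf 0); TLeaf 3; TNode false (TLeaf 0) (TLeaf 1);
      TNode false (TLeaf 2) (TLeaf 3)].

Definition rowsC : seq tree :=
  [:: TNode false (TNode true (TNode false (TLeaf 0) (TLeaf 3)) (TLeaf 4)) (TLeaf 6);
      TNode false (TLeaf 2) (TLeaf 4); TNode false (TLeaf 1) (TLeaf 3);
      TNode false (TNode false (TNode true (TLeaf 0) (TLeaf 1)) (TLeaf 2)) (TLeaf 5)].

Section Algebra.
Variable R : pzRingType.
Implicit Types f g : nat -> nat -> R.

(** Matrices are functions of two indices, which avoids casts between matrix sizes; [to_mx] returns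
    to genuine matrices. *)
Definition operand (rows : seq tree) h c f : nat -> nat -> R := fun i j =>
  tree_val (fun q => f (i + q %/ 2 * h) (j + q %% 2 * h)) (nth (TLeaf 0) rows c).

(* The operand of node [s] at depth [k] of the recursion tree; [h] is its size
   and the base-7 digits of [s] spell the path to it. *)
Fixpoint operands rows k s h f : nat -> nat -> R :=
  if k is k.+1 then operand rows h (s %% 7) (operands rows k (s %/ 7) (2 * h) f)
  else f.

Definition combine h (p : nat -> nat -> nat -> R) : nat -> nat -> R := fun i j =>
  tree_val (fun q => p q (i %% h) (j %% h)) (nth (TLeaf 0) rowsC (2 * (i %/ h) + j %/ h)).

(** Here [s] is a node with [k] levels below it. Its children are [7 * s + q], in agreement with the
    order of the digits in [operands]. *)
Fixpoint combines k s m (p : nat -> nat -> nat -> R) : nat -> nat -> R :=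
  if k is k.+1 then combine (2 ^ k * m) (fun q => combines k (7 * s + q) m p)
  else p s.

Definition mmul m f g : nat -> nat -> R := fun i j => (\sum_(l < m) f i l * g l j)%R.

Definition to_mx m f : 'M[R]_m := (\matrix_(i, j) f i j)%R.

Fixpoint smults d f g : seq (R * R) :=
  if d is d.+1 then
    flatten [seq smults d (operand rowsA (2 ^ d) c f) (operand rowsB (2 ^ d) c g)
            | c <- iota 0 7]
  else [:: (f 0 0, g 0 0)].

Lemma to_mx_mul m f g : (to_mx m f *m to_mx m g = to_mx m (mmul m f g))%R.
Proof.
by apply/matrixP => i j; rewrite !mxE; apply: eq_bigr => l _; rewrite !mxE.
Qed.

Lemma strassen_operands_to_mx m f g :
  strassen_operands (to_mx (m + m) f) (to_mx (m + m) g) =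
  [seq (to_mx m (operand rowsA m c f), to_mx m (operand rowsB m c g)) | c <- iota 0 7].
Proof.
rewrite /strassen_operands /=.
by do 7?[congr (_ :: _)]; congr (_, _); apply/matrixP => i j;
  rewrite !mxE /operand /= /pm ?mul0n ?mul1n ?addn0 ?(addnC m).
Qed.

Lemma strassen_combine_to_mx m p :
  to_mx (m + m) (combine m p) = strassen_combine [seq to_mx m (p c) | c <- iota 0 7].
Proof.
apply/matrixP => i j; rewrite /strassen_combine /= !mxE.
case: (split_ordP i) => {}i ->; rewrite mxE; case: (split_ordP j) => {}j ->;
  rewrite !mxE /combine ?lshift0; have m0 : 0 < m by case: (m) i => // -[].
all: have im := ltn_ord i; have jm := ltn_ord j.
all: by rewrite /= ?divnDl ?modnDl ?divnn ?m0 ?(divn_small im) ?(divn_small jm)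
  ?(modn_small im) ?(modn_small jm) /=.
Qed.

(** Strassen's identity is not proved again: [strassen_combineE] is transported through [to_mx] and
    read off entrywise. *)
Lemma combine_mmul m f g i j : i < m + m -> j < m + m ->
  combine m (fun c => mmul m (operand rowsA m c f) (operand rowsB m c g)) i j
    = mmul (m + m) f g i j.
Proof.
move=> im jm.
have E : to_mx (m + m) (combine m (fun c =>
    mmul m (operand rowsA m c f) (operand rowsB m c g))) = to_mx (m + m) (mmul (m + m) f g).
  rewrite strassen_combine_to_mx -to_mx_mul -strassen_combineE.
  by rewrite strassen_operands_to_mx -map_comp /=; do !rewrite to_mx_mul.
by move/matrixP/(_ (Ordinal im) (Ordinal jm)): E; rewrite !mxE.
Qed.

Lemma strassen_smults d f g :
  (strassen (to_mx (pow2 d) f) (to_mx (pow2 d) g)).2 = smults d f g.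
Proof.
elim: d f g => [|d IH] f g; first by rewrite /= !mxE.
transitivity (flatten (unzip2 [seq strassen ST.1 ST.2 | ST <-
  strassen_operands (to_mx (pow2 d + pow2 d) f) (to_mx (pow2 d + pow2 d) g)])) => //.
by rewrite strassen_operands_to_mx /smults -/smults -pow2E /unzip2 -!map_comp /= !IH.
Qed.

Lemma iota_mul N q : iota 0 (N * q) = flatten [seq iota (s * q) q | s <- iota 0 N].
Proof.
elim: N => [//|N IH]; rewrite mulSnr iotaD IH.
by rewrite -addn1 iotaD map_cat flatten_cat /= cats0.
Qed.

Lemma flatten_flatten (T : Type) (sss : seq (seq (seq T))) :
  flatten (flatten sss) = flatten (map flatten sss).
Proof. by elim: sss => //= ss sss IH; rewrite flatten_cat IH. Qed.

(** The induction splits off the deepest of the [k] levels, and [iota_mul] groups the node numbers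
    into blocks of seven siblings. The multiplications come in the same order as in the recursion,
    so the lists are equal and not merely permutations of each other. *)
Lemma smults_operands k e f g :
  smults (k + e) f g =
  flatten [seq smults e (operands rowsA k s (2 ^ e) f) (operands rowsB k s (2 ^ e) g)
          | s <- iota 0 (7 ^ k)].
Proof.
elim: k e => [|k IH] e; first by rewrite /= cats0.
rewrite addSnnS IH [7 ^ k.+1]expnSr iota_mul map_flatten flatten_flatten -!map_comp.
congr flatten; apply: eq_map => s.
rewrite -/(smults _ _ _) /comp -[s * 7]addn0 iotaDl -map_comp.
congr flatten; apply/eq_in_map => c; rewrite mem_iota => /= c7.
have -> : (s * 7 + c) %/ 7 = s by lia.
have -> : (s * 7 + c) %% 7 = c by lia.
by rewrite -expnS.
Qed.

(** Induction from the leaves to the root of a tree of depth [K]: the seven children of a node at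
    depth [K - k] are already products of operands, and [combine_mmul] assembles them. It is applied
    at the root, with [k = K] and [s = 0]. *)
Lemma combines_mmul k K e f g p s i j :
    k <= K ->
    (forall s i j, s < 7 ^ K -> i < 2 ^ e -> j < 2 ^ e ->
       p s i j = mmul (2 ^ e) (operands rowsA K s (2 ^ e) f)
                              (operands rowsB K s (2 ^ e) g) i j) ->
    s < 7 ^ (K - k) -> i < 2 ^ k * 2 ^ e -> j < 2 ^ k * 2 ^ e ->
  combines k s (2 ^ e) p i j =
    mmul (2 ^ k * 2 ^ e) (operands rowsA (K - k) s (2 ^ k * 2 ^ e) f)
                         (operands rowsB (K - k) s (2 ^ k * 2 ^ e) g) i j.
Proof.
move=> kK Hp; elim: k kK s i j => [|k IH] kK s i j sK im jm.
  by rewrite /= mul1n subn0 Hp ?mul1n //; move: sK im jm; rewrite subn0 mul1n.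
set h := 2 ^ k * 2 ^ e.
have h0 : 0 < h by rewrite muln_gt0 !expn_gt0.
have hE : 2 ^ k.+1 * 2 ^ e = h + h by rewrite expnS -mulnA mul2n addnn.
rewrite hE in im jm *; rewrite -combine_mmul // /= /combine.
have KE : K - k = (K - k.+1).+1 by lia.
have id : i %/ h <= 1 by rewrite -ltnS ltn_divLR // mul2n -addnn.
have jd : j %/ h <= 1 by rewrite -ltnS ltn_divLR // mul2n -addnn.
have eq q : q < 7 -> combines k (7 * s + q) (2 ^ e) p (i %% h) (j %% h) =
   mmul h (operand rowsA h q (operands rowsA (K - k.+1) s (h + h) f))
          (operand rowsB h q (operands rowsB (K - k.+1) s (h + h) g)) (i %% h) (j %% h).
  move=> q7; rewrite IH ?ltn_mod //; [|by lia|]; last first.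
    by rewrite KE expnS; lia.
  rewrite KE /= -/h.
  have -> : (7 * s + q) %% 7 = q by lia.
  have -> : (7 * s + q) %/ 7 = s by lia.
  by rewrite mul2n addnn.
move: id jd; case: (i %/ h) => [|[|//]] _; case: (j %/ h) => [|[|//]] _ /=;
  by rewrite !eq.
Qed.

End Algebra.

(** * Entries of the operands and of the product *)

(** The coefficient rows are program text while a path digit is a word, so the digit has to select
    its row by a chain of tests, of constant length here. *)
Fixpoint switch (e : expr) (i : nat) (cs : seq cmd) : cmd :=
  if cs is c :: cs then IfLe e (Cst i) c (switch e i.+1 cs) else Skip.

Lemma runs_switch (R : pzRingType) P w env aenv (h : heap R) e i cs v u rd ms wk sp sc :
    safe w env e -> den env e = v -> cost e = 1 -> i <= v < i + size cs ->
    i + size cs <= w ->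
    runs P w env aenv h (nth Skip cs (v - i)) u rd ms wk sp sc ->
  runs P w env aenv h (switch e i cs) u rd ms (wk + 3 * size cs) (sp + 3 * size cs) sc.
Proof.
move=> se de ce; elim: cs i => [|c cs IH] i /= iv iw H; first by lia.
apply: runs_if; rewrite //= ?ce ?de; try lia.
case: (leqP v i) => vi.
  have vE : v = i by lia.
  by rewrite vE subnn in H; apply: runs_le H _ _ _; lia.
have vE : v - i = (v - i.+1).+1 by lia.
rewrite vE /= in H.
by apply: runs_le (IH i.+1 _ _ H) _ _ _; lia.
Qed.

Definition dispatch leaf rows e x y d :=
  switch e 0 [seq compile leaf t x y d | t <- rows].
Arguments dispatch : simpl never.
Arguments rowsA : simpl never.
Arguments rowsB : simpl never.
Arguments rowsC : simpl never.

Local Notation "e1 [+] e2" := (Bin WAdd e1 e2) (at level 50, left associativity).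
Local Notation "e1 [-] e2" := (Bin WSub e1 e2) (at level 50, left associativity).
Local Notation "e1 [*] e2" := (Bin WMul e1 e2) (at level 40, left associativity).
Local Notation "e1 [/] e2" := (Bin WDiv e1 e2) (at level 40, left associativity).

(* Words of [entAB]: md k s i j h st off dof, that is 0 for A and 1 for B, level,
   node, position, node size, row length and offset of the source, destination.
   In [entAB_leaf] one more word is bound in front. *)
Definition entAB_leaf (self q x y : nat) (e : expr) : cmd :=
  Call self [:: Var 1; Var 2 [-] Cst 1; Var 3 [/] Cst 7;
      Var 4 [+] Cst (q %/ 2) [*] Var 6; Var 5 [+] Cst (q %% 2) [*] Var 6;
      Var 6 [+] Var 6; Var 7; Var 8; e] [:: x; y].

Definition entAB (self : nat) : cmd :=
  IfLe (Var 1) (Cst 0)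
    (Move (Cell 1 (Var 8)) (Cell 0 (Var 7 [+] (Var 3 [*] Var 6 [+] Var 4))))
    (Let (Var 0 [*] Cst 7 [+] (Var 2 [-] (Var 2 [/] Cst 7) [*] Cst 7))
      (dispatch (entAB_leaf self) (rowsA ++ rowsB) (Var 0) 0 1 (Var 9))).

(* Words of [entC]: k s i j hh m dof, where [hh] is the size of the matrix at
   level [k] and [m] that of the stored products. In [entC_leaf] two more words
   are bound in front, the second one being [hh / 2]. *)
Definition entC_leaf (self q x y : nat) (e : expr) : cmd :=
  Call self [:: Var 2 [-] Cst 1; Cst 7 [*] Var 3 [+] Cst q;
      Var 4 [-] (Var 4 [/] Var 1) [*] Var 1; Var 5 [-] (Var 5 [/] Var 1) [*] Var 1;
      Var 1; Var 7; e] [:: x; y].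

Definition entC (self : nat) : cmd :=
  IfLe (Var 0) (Cst 0)
    (Move (Cell 1 (Var 6))
       (Cell 0 (Var 1 [*] (Var 5 [*] Var 5) [+] (Var 2 [*] Var 5 [+] Var 3))))
    (Let (Var 4 [/] Cst 2)
      (Let (Cst 2 [*] (Var 3 [/] Var 0) [+] Var 4 [/] Var 0)
        (dispatch (entC_leaf self) rowsC (Var 0) 0 1 (Var 8)))).

Definition small (c : nat) (t : tree) :=
  (size (leaves t) <= 4) && all (fun q => q < c) (leaves t).

Section Entry.
Variables (R : pzRingType) (P : seq cmd) (w : nat).

(** Closed forms for recursions with at most four subcalls per level: the amounts subtracted in the
    subcalls pay for the overhead of the level. [ent_space] counts two cells for each inner node of
    a binary tree with [4 ^ k] leaves. *)
Definition ent_work k := 200 * 4 ^ k - 100.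
Definition ent_span k := 140 * k.+1.
Definition ent_space k := 2 * 4 ^ k - 2.

Lemma runs_small env (leaf : nat -> nat -> nat -> expr -> cmd) b (v : nat -> R)
    (h0 : heap R) k c t :
    2 < w -> small c t ->
    (forall q, q < c -> computes_at P w env b h0 (leaf q) (v q) (ent_work k + 28)
        (ent_span k + 28) (ent_space k)) ->
  computes_at P w env b h0 (compile leaf t) (tree_val v t)
    (ent_work k.+1 - 60) (ent_span k.+1 - 56) (ent_space k.+1).
Proof.
move=> w2 /andP[t4 /allP tc] leafH aenv h x y e bd dof *.
apply: runs_le (runs_compile w2 (fun q qt => leafH q (tc q qt))
  _ _ _ _ _ _ _ _ _ _ _) _ _ _ => //.
- have := leq_mul2r (ent_work k + 28 + 14) (size (leaves t)) 4.
  rewrite t4 orbT /ent_work expnS; have := expn_gt0 4 k.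
  by move: (_ * _) => X; lia.
- by rewrite /ent_span; lia.
have := leq_mul2r (ent_space k + 2) (size (leaves t)) 4.
rewrite t4 orbT /ent_space expnS; have := expn_gt0 4 k.
by move: (_ * _) => X; lia.
Qed.

Lemma runs_dispatch env aenv (leaf : nat -> nat -> nat -> expr -> cmd) b
    (v : nat -> R) (h : heap R) k c rows e x y d bd dof idx :
    2 < w -> all (small c) rows -> safe w env e -> cost e = 1 -> den env e = idx ->
    idx < size rows <= w ->
    x < size aenv -> y < size aenv -> nth 0 aenv x = b -> nth 0 aenv y = bd ->
    safe w env d -> cost d = 1 -> den env d = dof -> bd != b ->
    valid h (bd, dof) -> b < size h ->
    (forall q, q < c -> computes_at P w env b h (leaf q) (v q) (ent_work k + 28)
        (ent_span k + 28) (ent_space k)) ->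
  runs P w env aenv h (dispatch leaf rows e x y d)
    (cell_upd (bd, dof) (tree_val v (nth (TLeaf 0) rows idx)))
    (fun l => l.1 == b) [::] (ent_work k.+1 - 60 + 3 * size rows)
    (ent_span k.+1 - 56 + 3 * size rows) (ent_space k.+1).
Proof.
move=> w2 sm se ce de /andP[idx_s sw] xa ya xb yb sd cd dd nbd vd bh leafH.
have smi := elimT (all_nthP (TLeaf 0)) sm _ idx_s.
rewrite -(size_map (fun t => compile leaf t x y d) rows).
apply: (runs_switch (v := idx)) => //; rewrite ?size_map //.
rewrite subn0 (nth_map (TLeaf 0)) //.
exact: (runs_small w2 smi leafH).
Qed.

(** A call one level up drops the last digit of [s], moves the position into a quadrant and doubles
    the node size, which preserves [hsz * 2 ^ k = st]. The destination is general because inner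
    calls write to scratch cells. *)
Lemma runs_entAB self md k s i j hsz st off dof b bd (h : heap R) f :
    onth P self = Some (entAB self) ->
    md <= 1 -> s < 7 ^ k -> i < hsz -> j < hsz -> hsz * 2 ^ k = st ->
    20 + s + k + 2 * st + st * st + off < w ->
    (forall i j, i < st -> j < st -> load h (b, off + (i * st + j)) = Some (f i j)) ->
    b < size h -> bd != b -> valid h (bd, dof) ->
  runs P w [:: md; k; s; i; j; hsz; st; off; dof] [:: b; bd] h (entAB self)
    (cell_upd (bd, dof)
       (operands (if md is 0 then rowsA else rowsB) k s hsz f i j))
    (fun l => l.1 == b) [::] (ent_work k) (ent_span k) (ent_space k).
Proof.
move=> Ps md1; elim: k s i j hsz dof bd h => [|k IH] s i j hsz dof bd h.
  move=> s0 ih jh hst wb ld bh nbd vd; rewrite expn0 muln1 in hst.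
  have ist : i * st + st <= st * st by rewrite addnC -mulSn leq_mul2r -hst ih orbT.
  apply: runs_if => //=; try lia.
  apply: runs_move; rewrite //= ?ld ?eqxx //; try lia.
move=> sk ih jh hst wb ld bh nbd vd.
have h2st : (hsz + hsz) * 2 ^ k = st by rewrite -hst expnS mulnA muln2 addnn.
have hle : hsz + hsz <= st by rewrite -h2st leq_pmulr // expn_gt0.
(* There is no remainder instruction, so the last digit is computed by division and subtraction;
   [md] then selects the half of [rowsA ++ rowsB]. *)
have md7 : md * 7 + (s - s %/ 7 * 7) = md * 7 + s %% 7 by lia.
have k4 : 0 < 4 ^ k by rewrite expn_gt0.
have wE : ent_work k.+1 = 4 * (200 * 4 ^ k) - 100 by rewrite /ent_work expnS; lia.
have sE : ent_span k.+1 = 140 * k + 280 by rewrite /ent_span; lia.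
apply: runs_if; [by []|by rewrite /=; lia|by rewrite /=; lia|by rewrite /=; lia|].
rewrite [den _ _ <= _]/=; apply: runs_let; [|rewrite /=; lia|rewrite /=; lia|].
  by rewrite /=; lia.
rewrite [den _ _]/= md7.
set idx := md * 7 + s %% 7.
have idx14 : idx < 14 by rewrite /idx; lia.
pose row := nth (TLeaf 0) (rowsA ++ rowsB) idx.
have rowE : row = nth (TLeaf 0) (if md is 0 then rowsA else rowsB) (s %% 7).
  rewrite /row /idx nth_cat (_ : size rowsA = 7) //.
  case: md md1 {md7 idx idx14 row IH} => [|[|//]] _ /=.
    by rewrite ifT //; lia.
  by congr nth; lia.
pose v q := operands (if md is 0 then rowsA else rowsB) k (s %/ 7) (hsz + hsz) f
   (i + q %/ 2 * hsz) (j + q %% 2 * hsz).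
have leafH q : q < 4 -> computes_at P w
    [:: idx; md; k.+1; s; i; j; hsz; st; off; dof] b h (entAB_leaf self q) (v q)
    (ent_work k + 28) (ent_span k + 28) (ent_space k).
  move=> q4 aenv h1 x y e bd1 dof1 xa ya xb yb se ce de nbd1 vd1 bh1 ld1.
  have b1 : q %/ 2 * hsz <= hsz by rewrite -[X in _ <= X]mul1n leq_mul2r; lia.
  have b2 : q %% 2 * hsz <= hsz by rewrite -[X in _ <= X]mul1n leq_mul2r; lia.
  apply: (runs_call_add (K := 28) Ps).
  - by rewrite [all _ _]/= se; clear -q4 wb b1 b2 sk ih jh hle; lia.
  - by rewrite /= xa ya.
  - by rewrite /costs /= ce.
  rewrite [map _ _]/= [map _ [:: x; y]]/= xb yb de subn1.
  apply: IH => //; try by clear -sk b1 b2 ih jh wb; move: sk; rewrite ?expnS /=; lia.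
  by move=> i' j' ? ?; rewrite ld1 // ld.
rewrite (_ : cell_upd _ _ = cell_upd (bd, dof) (tree_val v row)); last first.
  by rewrite rowE [operands _ k.+1 _ _ _]/= /operand mul2n -addnn.
apply: runs_le; first apply: (runs_dispatch (k := k) (v := v) (c := 4) (idx := idx)).
- by lia.
- by [].
- by [].
- by [].
- by [].
- by rewrite idx14 (_ : size (rowsA ++ rowsB) = 14) //; lia.
all: try by [].
- by rewrite wE /=; lia.
- by rewrite sE /=; lia.
Qed.

(** The recursion goes down from the root: node [s] has depth [K - k], and a call moves to child
    [7 * s + q] with the position reduced modulo half the size. *)
Lemma runs_entC self K m k s i j dof b bd (h : heap R) (p : nat -> nat -> nat -> R) :
    onth P self = Some (entC self) ->
    k <= K -> s < 7 ^ (K - k) -> 0 < m -> i < 2 ^ k * m -> j < 2 ^ k * m ->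
    20 + 7 ^ K + K + 7 ^ K * (m * m) + 2 ^ K * m < w ->
    (forall s i j, s < 7 ^ K -> i < m -> j < m ->
       load h (b, s * (m * m) + (i * m + j)) = Some (p s i j)) ->
    b < size h -> bd != b -> valid h (bd, dof) ->
  runs P w [:: k; s; i; j; 2 ^ k * m; m; dof] [:: b; bd] h (entC self)
    (cell_upd (bd, dof) (combines k s m p i j))
    (fun l => l.1 == b) [::] (ent_work k) (ent_span k) (ent_space k).
Proof.
move=> Ps; elim: k s i j dof bd h => [|k IH] s i j dof bd h.
  rewrite subn0 mul1n => _ sK m0 im jm wb ld bh nbd vd.
  have sm : s * (m * m) + m * m <= 7 ^ K * (m * m).
    by rewrite addnC -mulSn leq_mul2r sK orbT.
  have ist : i * m + m <= m * m by rewrite addnC -mulSn leq_mul2r im orbT.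
  apply: runs_if => //=; try lia.
  apply: runs_move; rewrite //= ?ld ?eqxx //; try lia.
move=> kK sk m0 im jm wb ld bh nbd vd.
set H := 2 ^ k * m.
have H0 : 0 < H by rewrite muln_gt0 expn_gt0 m0.
have HE : 2 ^ k.+1 * m = H + H by rewrite expnS -mulnA mul2n addnn.
have HK : H + H <= 2 ^ K * m by rewrite -HE leq_mul2r leq_exp2l // kK orbT.
rewrite HE in im jm *.
have s7 : 7 * s + 7 <= 7 ^ K.
  have : 7 ^ (K - k.+1).+1 <= 7 ^ K by rewrite leq_exp2l; lia.
  by rewrite expnS; lia.
have sk' q : q < 7 -> 7 * s + q < 7 ^ (K - k).
  move=> q7; have -> : K - k = (K - k.+1).+1 by lia.
  by rewrite expnS; lia.
have k4 : 0 < 4 ^ k by rewrite expn_gt0.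
have wE : ent_work k.+1 = 4 * (200 * 4 ^ k) - 100 by rewrite /ent_work expnS; lia.
have sE : ent_span k.+1 = 140 * k + 280 by rewrite /ent_span; lia.
have HH2 : (H + H) %/ 2 = H by rewrite addnn -muln2 mulnK.
have Hw : H + H < w by clear -wb HK; lia.
have szC : size rowsC = 4 by [].
apply: runs_if; [by []|by rewrite /=; clear -Hw H0; lia
  |by rewrite /=; clear -wE k4; lia|by rewrite /=; clear -sE; lia|].
rewrite [den _ _ <= _]/=; apply: runs_let;
  [|by rewrite /=; clear -wE k4; lia|by rewrite /=; clear -sE; lia|].
  by rewrite /= HH2; clear -Hw wb; lia.
rewrite [den _ _]/= HH2.
have id : i %/ H <= 1 by rewrite -ltnS ltn_divLR // mul2n -addnn.
have jd : j %/ H <= 1 by rewrite -ltnS ltn_divLR // mul2n -addnn.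
have iM : i %/ H * H <= i := leq_trunc_div i H.
have jM : j %/ H * H <= j := leq_trunc_div j H.
have imE : i - i %/ H * H = i %% H by rewrite {1}(divn_eq i H) addKn.
have jmE : j - j %/ H * H = j %% H by rewrite {1}(divn_eq j H) addKn.
apply: runs_let; [|by rewrite /=; clear -wE k4; lia|by rewrite /=; clear -sE; lia|].
  by rewrite /=; move: (i %/ H) (j %/ H) id jd; clear -wb; lia.
rewrite [den _ _]/=.
set idx := 2 * (i %/ H) + j %/ H.
have idx4 : idx < 4 by rewrite /idx; move: (i %/ H) (j %/ H) id jd; clear; lia.
pose v q := combines k (7 * s + q) m p (i %% H) (j %% H).
have leafH q : q < 7 -> computes_at P w
    [:: idx; H; k.+1; s; i; j; H + H; m; dof] b h (entC_leaf self q) (v q)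
    (ent_work k + 28) (ent_span k + 28) (ent_space k).
  move=> q7 aenv h1 x y e bd1 dof1 xa ya xb yb se ce de nbd1 vd1 bh1 ld1.
  have bq : 7 * s + q < w by move: (2 ^ K * m) HK; clear -s7 q7 wb; lia.
  apply: (runs_call_add (K := 28) Ps).
  - rewrite [all _ _]/= se bq.
    move: (i %/ H * H) (i %/ H) (j %/ H * H) (j %/ H) iM id jM jd => a1 a2 a3 a4.
    clear -im jm Hw q7 wb kK bq; lia.
  - by rewrite /= xa ya.
  - by rewrite /costs /= ce.
  rewrite [map _ _]/= [map _ [:: x; y]]/= xb yb de subn1 imE jmE.
  apply: IH => //; [exact: ltnW | exact: sk' | exact: ltn_pmod | exact: ltn_pmod |].
  by move=> s' i' j' ? ? ?; rewrite ld1 // ld.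
have -> : combines k.+1 s m p i j = tree_val v (nth (TLeaf 0) rowsC idx) by [].
apply: runs_le; first apply: (runs_dispatch (k := k) (v := v) (c := 7) (idx := idx)).
- by clear -wb; lia.
- by [].
- by [].
- by [].
- by [].
- by rewrite idx4 szC; clear -wb; lia.
all: try by [].
- by rewrite wE szC /=; clear -k4; lia.
- by rewrite sE szC /=; clear; lia.
Qed.

End Entry.

(** * The program *)

Definition p_mul := 0.
Definition p_pow := 1.
Definition p_step := 2.
Definition p_opnd := 3.
Definition p_entAB := 4.
Definition p_comb := 5.
Definition p_entC := 6.
Definition p_mulpar := 7.
Definition p_mulser := 8.
Definition p_pad := 9.
Definition p_unpad := 10.
Definition p_size := 11.
Definition p_cut := 12.

(* Words: d side cut off; arrays: A B C. *)
Definition mul_proc : cmd :=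
  IfLe (Var 0) (Cst 0)
    (Arith RMul (Cell 2 (Var 3)) (Cell 0 (Var 3)) (Cell 1 (Var 3)))
    (Let ((Var 0 [+] Cst 4) [/] Cst 5)
      (Call p_pow [:: Var 0; Cst 1; Cst 1; Var 0; Var 1; Var 2; Var 3; Var 4]
         [:: 0; 1; 2])).

(* Words: kk p7 p2 k d side cut off, with [p7 = 7 ^ (k - kk)] and
   [p2 = 2 ^ (k - kk)]; procedures return no words, whence the tail call. *)
Definition pow_proc : cmd :=
  IfLe (Var 0) (Cst 0)
    (Call p_step [:: Var 1; Var 2; Var 3; Var 4; Var 5; Var 6; Var 7] [:: 0; 1; 2])
    (Call p_pow [:: Var 0 [-] Cst 1; Cst 7 [*] Var 1; Cst 2 [*] Var 2; Var 3;
       Var 4; Var 5; Var 6; Var 7] [:: 0; 1; 2]).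

(* Words: m p7 p2 k d side cut off; arrays: P SB SA A B C. *)
Definition step_body : cmd :=
  Seq (Call p_opnd [:: Cst 0; Var 1 [*] (Var 0 [*] Var 0); Cst 0; Var 3; Var 0;
         Var 5; Var 7] [:: 3; 2])
  (Seq (Call p_opnd [:: Cst 0; Var 1 [*] (Var 0 [*] Var 0); Cst 1; Var 3; Var 0;
         Var 5; Var 7] [:: 4; 1])
  (Seq (IfLe (Var 4) (Var 6)
         (Call p_mulser [:: Cst 0; Var 1; Var 4 [-] Var 3; Var 0; Var 6] [:: 2; 1; 0])
         (Call p_mulpar [:: Cst 0; Var 1; Var 4 [-] Var 3; Var 0; Var 6] [:: 2; 1; 0]))
    (Call p_comb [:: Cst 0; Var 5 [*] Var 5; Var 3; Var 0; Var 5; Var 7] [:: 0; 5]))).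

Definition step_proc : cmd :=
  Let (Var 4 [/] Var 1)
    (New (Var 1 [*] (Var 0 [*] Var 0))
      (New (Var 1 [*] (Var 0 [*] Var 0))
        (New (Var 1 [*] (Var 0 [*] Var 0)) step_body))).

(* Words: idx 1 md k m side off. *)
Definition opnd_body : cmd :=
  Call p_entAB [:: Var 2; Var 3; Var 0 [/] (Var 4 [*] Var 4);
    Var 0 [/] Var 4 [-] Var 0 [/] (Var 4 [*] Var 4) [*] Var 4;
    Var 0 [-] Var 0 [/] Var 4 [*] Var 4; Var 4; Var 5; Var 6; Var 0] [:: 0; 1].

(* Words: idx 1 k m side off. *)
Definition comb_body : cmd :=
  Call p_entC [:: Var 2; Cst 0; Var 0 [/] Var 4; Var 0 [-] Var 0 [/] Var 4 [*] Var 4;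
    Var 4; Var 3; Var 5 [+] Var 0] [:: 0; 1].

(* Words: s 1 d m cut. *)
Definition mul_body : cmd :=
  Call p_mul [:: Var 2; Var 3; Var 4; Var 0 [*] (Var 3 [*] Var 3)] [:: 0; 1; 2].

(* Words: idx 1 n side, and then j i in front. *)
Definition pad_body : cmd :=
  Let (Var 0 [/] Var 3)
    (Let (Var 1 [-] Var 0 [*] Var 4)
      (IfLe (Var 4) (Var 1) (Zero (Cell 1 (Var 2)))
        (IfLe (Var 4) (Var 0) (Zero (Cell 1 (Var 2)))
          (Move (Cell 1 (Var 2)) (Cell 0 (Var 1 [*] Var 4 [+] Var 0)))))).

Definition unpad_body : cmd :=
  Move (Cell 1 (Var 0))
    (Cell 0 (Var 0 [/] Var 2 [*] Var 3 [+] (Var 0 [-] Var 0 [/] Var 2 [*] Var 2))).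

(* Words: d side n. *)
Definition size_proc : cmd :=
  IfLe (Var 2) (Var 1)
    (Call p_cut [:: Cst 0; Cst 1; Var 0; Var 1; Var 2] [:: 0; 1; 2])
    (Call p_size [:: Var 0 [+] Cst 1; Var 1 [+] Var 1; Var 2] [:: 0; 1; 2]).

(* Words: cut pw d side n; arrays: CP BP AP A B C. *)
Definition main_body : cmd :=
  Seq (Call p_pad [:: Cst 0; Var 3 [*] Var 3; Var 4; Var 3] [:: 3; 2])
  (Seq (Call p_pad [:: Cst 0; Var 3 [*] Var 3; Var 4; Var 3] [:: 4; 1])
  (Seq (Call p_mul [:: Var 2; Var 3; Var 0; Cst 0] [:: 2; 1; 0])
    (Call p_unpad [:: Cst 0; Var 4 [*] Var 4; Var 4; Var 3] [:: 0; 5]))).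

(** Words: cut pw d side n, with [pw = 7 ^ cut]. The search stops at the least [cut] with
    [d < 7 ^ cut]. *)
Definition cut_proc : cmd :=
  IfLe (Var 1) (Var 2)
    (Call p_cut [:: Var 0 [+] Cst 1; Cst 7 [*] Var 1; Var 2; Var 3; Var 4] [:: 0; 1; 2])
    (New (Var 3 [*] Var 3) (New (Var 3 [*] Var 3) (New (Var 3 [*] Var 3) main_body))).

Definition strassen_procs : seq cmd :=
  [:: mul_proc; pow_proc; step_proc; loop Par p_opnd 5 2 opnd_body; entAB p_entAB;
      loop Par p_comb 4 2 comb_body; entC p_entC; loop Par p_mulpar 3 3 mul_body;
      loop Seq p_mulser 3 3 mul_body; loop Par p_pad 2 2 pad_body;
      loop Par p_unpad 2 2 unpad_body; size_proc; cut_proc].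

Definition strassenW : program :=
  Program strassen_procs (Call p_size [:: Cst 0; Cst 1; Var 0] [:: 0; 1; 2]).

Lemma flatten_nil (T S : Type) (s : seq S) : flatten [seq [::] | _ <- s] = [::] :> seq T.
Proof. by elim: s. Qed.

Lemma block_upd1 (R : pzRingType) b off i (v : nat -> R) :
  block_upd b (off + i * 1) 1 (fun o => v (i * 1 + o)) =1 cell_upd (b, off + i) (v i).
Proof.
move=> [b' o]; rewrite /block_upd /cell_upd /= xpair_eqE muln1 addn1 ltnS -eqn_leq eq_sym.
by rewrite [off + i == o]eq_sym; case: ifP => // /andP[_ /eqP->]; rewrite subnn addn0.
Qed.

(** * The loops that fill the operand buffers and the result *)

Section Loops.
Variables (R : pzRingType) (w : nat).
Notation P := strassen_procs.

Lemma runs_opnd md k m off b bd (h : heap R) f e :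
    let side := m * 2 ^ k in let N := 7 ^ k * (m * m) in
    md <= 1 -> 0 < m -> N <= 2 ^ e -> N < w ->
    20 + 7 ^ k + k + 2 * side + side * side + off < w ->
    (forall i j, i < side -> j < side ->
       load h (b, off + (i * side + j)) = Some (f i j)) ->
    b < size h -> bd != b -> N <= nth 0 (shape h) bd ->
  runs P w [:: 0; N; md; k; m; side; off] [:: b; bd] h
    (loop Par p_opnd 5 2 opnd_body)
    (block_upd bd 0 N (fun o => operands (if md is 0 then rowsA else rowsB) k
       (o %/ (m * m)) m f (o %/ m %% m) (o %% m)))
    (fun l => l.1 == b) [::] (N * (ent_work k + 150)) (ent_span k + 40 + 60 * e.+1)
    (N * ent_space k).
Proof.
move=> side N md1 m0 Ne Nw wb ld bh nbd szd.
set v := fun o => operands _ _ _ _ _ _ _.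
have N0 : 0 < N by rewrite !muln_gt0 expn_gt0 m0.
have body i (h1 : heap R) : i < N -> shape h1 = shape h ->
   (forall l, l.1 != bd -> load h1 l = load h l) ->
   runs P w [:: i; 1; md; k; m; side; off] [:: b; bd] h1 opnd_body
     (block_upd bd (0 + i * 1) 1 (fun o => v (i * 1 + o))) (fun l => l.1 == b)
     [::] (ent_work k + 40) (ent_span k + 40) (ent_space k).
  move=> iN sh1 ld1.
  have s7 : i %/ (m * m) < 7 ^ k by rewrite ltn_divLR // muln_gt0 m0.
  have j1 : i %/ m * m <= i := leq_trunc_div i m.
  have jE : i - i %/ m * m = i %% m by rewrite {1}(divn_eq i m) addKn.
  have iE : i %/ m - i %/ (m * m) * m = i %/ m %% m.
    by rewrite divnMA {1}(divn_eq (i %/ m) m) addKn.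
  have i1 : i %/ (m * m) * m <= i %/ m by rewrite divnMA leq_trunc_div.
  have im : i %/ m <= i := leq_div i m.
  have m2 : m * m <= N by rewrite leq_pmull // expn_gt0.
  apply: (runs_call_add (P := P) (p := p_entAB) (c := entAB p_entAB) erefl).
  - rewrite [all _ _]/=.
    move: (i %/ m * m) (i %/ m) (i %/ (m * m) * m) (i %/ (m * m)) j1 im i1 s7 => a1 a2 a3 a4.
    clear -iN Nw wb m2; lia.
  - by [].
  - by [].
  rewrite [map _ _]/= [map _ [:: 0; 1]]/= jE iE.
  apply: runs_weaken (runs_entAB (off := off) (f := f)
      (erefl : onth P p_entAB = Some _) md1 s7 _ _ erefl _ _ _ nbd _)
      _ _ _ _ _.
  - by rewrite ltn_mod.
  - by rewrite ltn_mod.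
  - by rewrite -/side; lia.
  - move=> i' j' i's j's; rewrite ld1; first exact: ld.
    by rewrite /= eq_sym.
  - by rewrite (shape_size sh1).
  - by rewrite validE sh1 /=; apply: leq_trans szd.
  - by move=> l; rewrite block_upd1.
  - by move=> l ->; rewrite orbT.
  - exact: leqnn.
  - exact: leqnn.
  exact: leqnn.
(* Five words and two arrays give [loop_overhead 5 2 = 54], which fits into the constants 150 (at
   least [40 + 2 * 54]) and 60 of the statement. *)
have H := @runs_block_loop R P w p_opnd true opnd_body [:: md; k; m; side; off] [:: b; bd]
  h bd 0 N 1 v (fun l => l.1 == b) (fun=> [::]) (ent_work k + 40) (ent_span k + 40)
  (ent_space k) e erefl _ Nw _ _ isT body.
rewrite muln1 flatten_nil in H.
apply: runs_le (H _ _ _) _ _ _.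
- by rewrite N0.
- by lia.
- by move=> l /eqP->; rewrite eq_sym.
- by rewrite -addnA leq_mul2l orbC leq_add2l.
- by rewrite -!addnA !leq_add2l leq_mul2r orbT.
exact: leqnn.
Qed.

Lemma runs_comb k m off b c (h : heap R) p e :
    let side := 2 ^ k * m in
    0 < m -> side * side <= 2 ^ e ->
    20 + 7 ^ k + k + 7 ^ k * (m * m) + side + side * side + off < w ->
    (forall s i j, s < 7 ^ k -> i < m -> j < m ->
       load h (b, s * (m * m) + (i * m + j)) = Some (p s i j)) ->
    b < size h -> c != b -> off + side * side <= nth 0 (shape h) c ->
  runs P w [:: 0; side * side; k; m; side; off] [:: b; c] h
    (loop Par p_comb 4 2 comb_body)
    (block_upd c off (side * side) (fun o => combines k 0 m p (o %/ side) (o %% side)))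
    (fun l => l.1 == b) [::] (side * side * (ent_work k + 150))
    (ent_span k + 40 + 60 * e.+1) (side * side * ent_space k).
Proof.
move=> side m0 Ne wb ld bh nbd szd.
set v := fun o => combines _ _ _ _ _ _.
have s0 : 0 < side by rewrite muln_gt0 expn_gt0 m0.
have body i (h1 : heap R) : i < side * side -> shape h1 = shape h ->
   (forall l, l.1 != c -> load h1 l = load h l) ->
   runs P w [:: i; 1; k; m; side; off] [:: b; c] h1 comb_body
     (block_upd c (off + i * 1) 1 (fun o => v (i * 1 + o))) (fun l => l.1 == b)
     [::] (ent_work k + 40) (ent_span k + 40) (ent_space k).
  move=> iN sh1 ld1.
  have i1 : i %/ side * side <= i := leq_trunc_div i side.
  have jE : i - i %/ side * side = i %% side by rewrite {1}(divn_eq i side) addKn.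
  have im : i %/ side <= i := leq_div i side.
  apply: (runs_call_add (P := P) (p := p_entC) (c := entC p_entC) erefl).
  - rewrite [all _ _]/=.
    move: (i %/ side * side) (i %/ side) i1 im => a1 a2.
    clear -iN wb; lia.
  - by [].
  - by [].
  rewrite [map _ _]/= [map _ [:: 0; 1]]/= jE.
  apply: runs_weaken (runs_entC (K := k) (p := p)
      (erefl : onth P p_entC = Some _) (leqnn _) _ m0 _ _ _ _ _ nbd _)
      _ _ _ _ _.
  - by rewrite subnn.
  - by rewrite -/side ltn_divLR.
  - by rewrite -/side ltn_mod.
  - by rewrite -/side; lia.
  - move=> s i' j' ss i's j's; rewrite ld1; first exact: ld.
    by rewrite /= eq_sym.
  - by rewrite (shape_size sh1).
  - by rewrite validE sh1 /=; apply: leq_trans szd; rewrite ltn_add2l.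
  - by move=> l; rewrite block_upd1.
  - by move=> l ->; rewrite orbT.
  - exact: leqnn.
  - exact: leqnn.
  exact: leqnn.
have H := @runs_block_loop R P w p_comb true comb_body [:: k; m; side; off] [:: b; c]
  h c off (side * side) 1 v (fun l => l.1 == b) (fun=> [::]) (ent_work k + 40)
  (ent_span k + 40) (ent_space k) e erefl _ _ _ _ isT body.
rewrite muln1 flatten_nil in H.
apply: runs_le (H _ _ _ _) _ _ _.
- by rewrite muln_gt0 s0.
- by lia.
- by lia.
- by move=> l /eqP->; rewrite eq_sym.
- by rewrite -addnA leq_mul2l orbC leq_add2l.
- by rewrite -!addnA !leq_add2l leq_mul2r orbT.
exact: leqnn.
Qed.

End Loops.

(** * Products *)

Lemma leq_expl m n e : m <= n -> m ^ e <= n ^ e.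
Proof. by case: e => // e mn; rewrite leq_exp2r. Qed.

Lemma index_lt S m s i j : s < S -> i < m -> j < m ->
  s * (m * m) + (i * m + j) < S * (m * m).
Proof.
move=> sS im jm.
have : i * m + m <= m * m by rewrite addnC -mulSn leq_mul2r im orbT.
have : s * (m * m) + m * m <= S * (m * m) by rewrite addnC -mulSn leq_mul2r sS orbT.
by lia.
Qed.

Lemma index_div m i j : j < m -> (i * m + j) %/ m = i.
Proof. by move=> jm; rewrite divnMDl ?divn_small ?addn0 //; case: m jm. Qed.

Lemma index_mod m i j : j < m -> (i * m + j) %% m = j.
Proof. by move=> jm; rewrite modnMDl modn_small. Qed.

Lemma index_div2 m s i j : i < m -> j < m -> (s * (m * m) + (i * m + j)) %/ (m * m) = s.
Proof.
move=> im jm; apply: index_div.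
by have := @index_lt 1 m 0 i j (ltn0Sn _) im jm; rewrite mul1n.
Qed.

Lemma index_divmod m s i j : i < m -> j < m ->
  (s * (m * m) + (i * m + j)) %/ m %% m = i.
Proof.
move=> im jm; rewrite mulnA addnA -mulnDl index_div //; exact: index_mod.
Qed.

Lemma index_mod2 m s i j : j < m -> (s * (m * m) + (i * m + j)) %% m = j.
Proof. by move=> jm; rewrite mulnA addnA -mulnDl index_mod. Qed.

Section BlockUpd.
Variable R : Type.
Implicit Type v : nat -> R.

Lemma block_upd_in b off len v o : o < len ->
  block_upd b off len v (b, off + o) = Some (v o).
Proof. by move=> lo; rewrite /block_upd /= eqxx addKn leq_addr ltn_add2l lo. Qed.

Lemma block_upd_out b off len v l : l.1 != b -> block_upd b off len v l = None.
Proof. by rewrite /block_upd => /negPf->. Qed.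

Lemma eq_block_upd b off len v v' : (forall o, o < len -> v o = v' o) ->
  block_upd b off len v =1 block_upd b off len v'.
Proof.
move=> e l; rewrite /block_upd; case: ifP => // /andP[_ h]; rewrite e //; lia.
Qed.

End BlockUpd.

Section Mul.
Variables (R : pzRingType) (w cut : nat).
Notation P := strassen_procs.

(** The contract of [mul_proc]. All three arrays are used from the same offset, so that subproducts
    can live side by side in shared buffers. The word bound uses [28 = 7 * 4]: [28 ^ d] dominates
    [7 ^ k] nodes times [4 ^ e] entries. *)
Definition mul_ok d W S C :=
  forall off a b c (h : heap R) f g,
    off + 100 * 28 ^ d < w ->
    (forall i j, i < 2 ^ d -> j < 2 ^ d ->
       load h (a, off + (i * 2 ^ d + j)) = Some (f i j)) ->
    (forall i j, i < 2 ^ d -> j < 2 ^ d ->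
       load h (b, off + (i * 2 ^ d + j)) = Some (g i j)) ->
    c != a -> c != b -> off + 2 ^ d * 2 ^ d <= nth 0 (shape h) c ->
  runs P w [:: d; 2 ^ d; cut; off] [:: a; b; c] h mul_proc
    (block_upd c off (2 ^ d * 2 ^ d)
       (fun o => mmul (2 ^ d) f g (o %/ 2 ^ d) (o %% 2 ^ d)))
    (fun l => (l.1 == a) || (l.1 == b)) (smults d f g) W S C.

Definition mul_loop_span k e S :=
  if k + e <= cut then 7 ^ k * (S + 124) else S + 20 + 52 * (3 * k).+1.

Lemma runs_mul_loop k e W S C sa sb sp (h : heap R) f g :
    let m := 2 ^ e in
    mul_ok e W S C -> 0 < k -> 100 * 28 ^ (k + e) < w ->
    (forall s i j, s < 7 ^ k -> i < m -> j < m ->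
       load h (sa, s * (m * m) + (i * m + j)) = Some (operands rowsA k s m f i j)) ->
    (forall s i j, s < 7 ^ k -> i < m -> j < m ->
       load h (sb, s * (m * m) + (i * m + j)) = Some (operands rowsB k s m g i j)) ->
    sp != sa -> sp != sb -> 7 ^ k * (m * m) <= nth 0 (shape h) sp ->
  runs P w [:: 0; 7 ^ k; e; m; cut] [:: sa; sb; sp] h
    (if k + e <= cut then loop Seq p_mulser 3 3 mul_body
     else loop Par p_mulpar 3 3 mul_body)
    (block_upd sp 0 (7 ^ k * (m * m)) (fun o =>
       mmul m (operands rowsA k (o %/ (m * m)) m f) (operands rowsB k (o %/ (m * m)) m g)
         (o %/ m %% m) (o %% m)))
    (fun l => (l.1 == sa) || (l.1 == sb)) (smults (k + e) f g)
    (7 ^ k * (W + 124)) (mul_loop_span k e S) (if k + e <= cut then C else 7 ^ k * C).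
Proof.
move=> m IH k0 wb lda ldb nsa nsb szp.
have m0 : 0 < m by rewrite expn_gt0.
have N28 : 7 ^ k * (m * m) + 28 * 28 ^ e <= 2 * 28 ^ (k + e).
  have -> : m * m = 4 ^ e by rewrite /m -expnMn.
  rewrite mul2n -addnn expnD leq_add //.
    by apply: leq_mul; apply: leq_expl; lia.
  apply: leq_mul => //; case: (k) k0 => // k' _.
  by rewrite expnS leq_pmulr ?expn_gt0.
have k7w : 7 ^ k + 10 < w.
  have : 7 ^ k <= 28 ^ (k + e).
    by rewrite expnD -[7 ^ k]muln1 leq_mul ?expn_gt0 // leq_expl //; lia.
  have : 0 < 28 ^ (k + e) by rewrite expn_gt0.
  by lia.
set v := fun o => _.
pose ms s := smults e (operands rowsA k s m f) (operands rowsB k s m g).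
have body s (h1 : heap R) : s < 7 ^ k -> shape h1 = shape h ->
    (forall l, l.1 != sp -> load h1 l = load h l) ->
    runs P w [:: s; 1; e; m; cut] [:: sa; sb; sp] h1 mul_body
      (block_upd sp (0 + s * (m * m)) (m * m) (fun o => v (s * (m * m) + o)))
      (fun l => (l.1 == sa) || (l.1 == sb)) (ms s) (W + 20) (S + 20) C.
  move=> s7 sh1 ld1.
  have sN : s * (m * m) + m * m <= 7 ^ k * (m * m).
    by rewrite addnC -mulSn leq_mul2r s7 orbT.
  have mm0 : m <= m * m by rewrite leq_pmulr.
  apply: (runs_call_add (P := P) (p := p_mul) (c := mul_proc) erefl).
  - rewrite [all _ _]/=; clear -sN N28 wb mm0 m0; lia.
  - by [].
  - by [].
  rewrite [map _ _]/= [map _ [:: 0; 1; 2]]/=.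
  apply: runs_weaken (IH _ sa sb sp h1 (operands rowsA k s m f) (operands rowsB k s m g)
    _ _ _ nsa nsb _) _ _ _ _ _.
  - by clear -sN N28 wb mm0 m0; lia.
  - by move=> i j im jm; rewrite ld1 ?lda //= eq_sym.
  - by move=> i j im jm; rewrite ld1 ?ldb //= eq_sym.
  - by rewrite sh1; apply: leq_trans szp.
  - rewrite add0n -/m; apply: eq_block_upd => o om.
    have om' : o %/ m < m by rewrite ltn_divLR.
    have oE : s * (m * m) + o = s * (m * m) + (o %/ m * m + o %% m).
      by rewrite -divn_eq.
    by rewrite /v oE index_div2 ?index_divmod ?index_mod2 // ltn_mod.
  - by move=> l ->; rewrite orbT.
  - exact: leqnn.
  - exact: leqnn.
  exact: leqnn.
have mm0 : 0 < m * m by rewrite muln_gt0 m0.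
(* Since [7 <= 2 ^ 3], the fork tree over the subproducts has height at most [3 * k]. *)
have k2 : 0 < 7 ^ k <= 2 ^ (3 * k).
  by rewrite expn_gt0 /= expnM leq_expl.
have rdP (l : loc) : (l.1 == sa) || (l.1 == sb) -> l.1 != sp.
  by case/orP => /eqP->; rewrite eq_sym.
have H par p Pp := @runs_block_loop R P w p par mul_body [:: e; m; cut] [:: sa; sb; sp]
  h sp 0 (7 ^ k) (m * m) v (fun l => (l.1 == sa) || (l.1 == sb)) ms (W + 20)
  (S + 20) C (3 * k) Pp k2 ltac:(lia) ltac:(lia) rdP mm0 body.
have -> : smults (k + e) f g = flatten [seq ms i | i <- iota 0 (7 ^ k)].
  exact: smults_operands.
rewrite /mul_loop_span; case: leqP => _.
  apply: runs_le (H false p_mulser erefl) _ _ _.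
  - by rewrite -addnA leq_mul2l orbC leq_add2l.
  - by rewrite -addnA leq_mul2l orbC leq_add2l.
  exact: leqnn.
apply: runs_le (H true p_mulpar erefl) _ _ _.
- by rewrite -addnA leq_mul2l orbC leq_add2l.
- exact: leqnn.
exact: leqnn.
Qed.

(** In units of [7 ^ k * 4 ^ (k + e)], each of the three entry loops has work at most 350. For
    space, the three buffers take at most 3, the scratch cells of the operand loops 2 and those of
    the combining loop 2, which makes 7. *)
Definition step_work k e W := 1050 * (7 ^ k * 4 ^ (k + e)) + 7 ^ k * (W + 124) + 120.
Definition step_span k e S :=
  3 * (ent_span k + 40 + 60 * (3 * (k + e)).+1) + mul_loop_span k e S + 120.
Definition step_space k e C :=
  7 * (7 ^ k * 4 ^ (k + e)) + (if k + e <= cut then C else 7 ^ k * C).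

(* SA, SB and P become the blocks [z], [z + 1] and [z + 2], where [z] is the size
   of the heap. *)
Lemma runs_step k e W S C off a b c (h : heap R) f g :
    let d := k + e in
    mul_ok e W S C -> 0 < k ->
    off + 100 * 28 ^ d < w ->
    (forall i j, i < 2 ^ d -> j < 2 ^ d ->
       load h (a, off + (i * 2 ^ d + j)) = Some (f i j)) ->
    (forall i j, i < 2 ^ d -> j < 2 ^ d ->
       load h (b, off + (i * 2 ^ d + j)) = Some (g i j)) ->
    c != a -> c != b -> off + 2 ^ d * 2 ^ d <= nth 0 (shape h) c ->
  runs P w [:: 7 ^ k; 2 ^ k; k; d; 2 ^ d; cut; off] [:: a; b; c] h step_proc
    (block_upd c off (2 ^ d * 2 ^ d)
       (fun o => mmul (2 ^ d) f g (o %/ 2 ^ d) (o %% 2 ^ d)))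
    (fun l => (l.1 == a) || (l.1 == b)) (smults d f g)
    (step_work k e W) (step_span k e S) (step_space k e C).
Proof.
move=> d IH k0 wb lda ldb nca ncb szc.
pose m := 2 ^ e; pose N := 7 ^ k * (m * m); pose side := 2 ^ d; pose z := size h.
have m0 : 0 < m by rewrite expn_gt0.
have sE : side = m * 2 ^ k by rewrite mulnC -expnD.
have sE' : side = 2 ^ k * m by rewrite -expnD.
have s0 : 0 < side by rewrite expn_gt0.
have mmE : m * m = 4 ^ e by rewrite /m -expnMn.
have ssE : side * side = 4 ^ d by rewrite /side -expnMn.
have NE : N = 7 ^ k * 4 ^ e by rewrite /N mmE.
have phiE : N * 4 ^ k = 7 ^ k * 4 ^ d by rewrite NE -mulnA -expnD addnC.
have ss_phi : side * side * 4 ^ k <= 7 ^ k * 4 ^ d.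
  by rewrite ssE mulnC leq_mul2r leq_expl ?orbT.
have four : 0 < 4 ^ k by rewrite expn_gt0.
have N8 : N <= 2 ^ (3 * d).
  by rewrite NE expnM expnD leq_mul ?leq_expl.
have ss8 : side * side <= 2 ^ (3 * d) by rewrite ssE expnM leq_expl.
have N28 : N <= 28 ^ d.
  by rewrite NE (expnD _ k) leq_mul ?leq_expl.
have k28 : 7 ^ k <= 28 ^ d.
  by rewrite (expnD _ k) -[7 ^ k]muln1 leq_mul ?expn_gt0 ?leq_expl.
have ss28 : side * side <= 28 ^ d by rewrite ssE leq_expl.
have side_ss : side <= side * side by rewrite leq_pmulr.
have k2_28 : 2 ^ k <= 7 ^ k by rewrite leq_expl.
have k_lt : k < 2 ^ k by rewrite ltn_expl.
have d_lt : d < side by rewrite ltn_expl.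
have m_side : m <= side by rewrite sE leq_pmulr ?expn_gt0.
have mm_ss : m * m <= side * side by rewrite leq_mul.
have divE : side %/ 2 ^ k = m by rewrite sE mulnK ?expn_gt0.
have dkE : d - k = e by rewrite addKn.
have zh : forall l x, load h l = Some x -> l.1 < z.
  by move=> l x /load_valid/valid_size.
have az : a < z by apply: (zh (a, _)); apply: (lda 0 0).
have bz : b < z by apply: (zh (b, _)); apply: (ldb 0 0).
have cz : c < z.
  apply: (@valid_size _ h (c, off)); rewrite validE /=; apply: leq_trans szc.
  by rewrite -addn1 leq_add2l muln_gt0 s0.
pose vX (md : nat) (F : nat -> nat -> R) o := operands (if md is 0 then rowsA else rowsB)
  k (o %/ (m * m)) m F (o %/ m %% m) (o %% m).
pose uA := block_upd z 0 N (vX 0 f); pose uB := block_upd z.+1 0 N (vX 1 g).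
pose uP := block_upd z.+2 0 N (fun o =>
       mmul m (operands rowsA k (o %/ (m * m)) m f) (operands rowsB k (o %/ (m * m)) m g)
         (o %/ m %% m) (o %% m)).
set uC := block_upd c _ _ _.
(* The cells that may be read while the first [n] temporary blocks are live. *)
pose rdn n (l : loc) := [|| l.1 == a, l.1 == b | z <= l.1 < z + n].
have out b1 l b2 n1 n2 v1 : l.1 = b2 -> b2 != b1 -> @block_upd R b1 n1 n2 v1 l = None.
  by move=> e1 ne; rewrite block_upd_out ?e1.
(* Space adds up over parallel branches, so the scratch cells of all entries of a loop count
   simultaneously. The buffers are charged separately, by the three allocations. *)
pose body_space := N * ent_space k + side * side * ent_space k +
   (if d <= cut then C else 7 ^ k * C).
have body (h3 : heap R) : shape h3 = rcons (rcons (rcons (shape h) N) N) N ->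
    load h3 =1 load h ->
    runs P w [:: m; 7 ^ k; 2 ^ k; k; d; side; cut; off] [:: z.+2; z.+1; z; a; b; c] h3
      step_body (ovr (ovr (ovr uC uP) uB) uA) (rdn 3) (smults d f g)
      (step_work k e W - 24) (step_span k e S - 24) body_space.
  move=> sh3 ld3.
  have sz3 : size h3 = z.+3 by rewrite -(size_map size) -/(shape h3) sh3 !size_rcons size_map.
  have shc : shape h3 = shape h ++ [:: N; N; N] by rewrite sh3 -!cats1 -!catA.
  have szN i : i < 3 -> nth 0 (shape h3) (z + i) = N.
    move=> i3; rewrite shc nth_cat size_map -/z ltnNge leq_addr addKn /=.
    by case: i i3 => [|[|[|]]].
  have szC : nth 0 (shape h3) c = nth 0 (shape h) c by rewrite shc nth_cat size_map -/z cz.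
  have budgetN x : N * (ent_work k + 150) + x <= 350 * (7 ^ k * 4 ^ d) + x.
    rewrite leq_add2r -phiE mulnCA leq_mul2l /ent_work; apply/orP; right.
    by move: (4 ^ k) four => X; lia.
  have budgetS x : side * side * (ent_work k + 150) + x <= 350 * (7 ^ k * 4 ^ d) + x.
    rewrite leq_add2r (leq_trans _ (leq_mul (leqnn 350) ss_phi)) //.
    rewrite mulnCA leq_mul2l /ent_work; apply/orP; right.
    by move: (4 ^ k) four => X; lia.
  set env := [:: m; 7 ^ k; 2 ^ k; k; d; side; cut; off].
  set aenv := [:: z.+2; z.+1; z; a; b; c].
  pose spO := ent_span k + 40 + 60 * (3 * d).+1.
  have rO md x y src dst F (h' : heap R) : md <= 1 -> x < 6 -> y < 6 ->
      nth 0 aenv x = src -> nth 0 aenv y = dst ->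
      (forall i j, i < side -> j < side ->
         load h' (src, off + (i * side + j)) = Some (F i j)) ->
      src < size h' -> dst != src -> N <= nth 0 (shape h') dst ->
      runs P w env aenv h' (Call p_opnd [:: Cst 0; Var 1 [*] (Var 0 [*] Var 0);
         Cst md; Var 3; Var 0; Var 5; Var 7] [:: x; y])
       (block_upd dst 0 N (vX md F)) (fun l => l.1 == src) [::]
       (350 * (7 ^ k * 4 ^ d) + 20) (spO + 20) body_space.
    move=> md1 x6 y6 xs yd ld' src' nds szd'.
    apply: runs_le (budgetN 20) (leqnn _) _.
      apply: (runs_call_add (P := P) (p := p_opnd) (c := loop Par p_opnd 5 2 opnd_body) erefl).
      - rewrite [all _ _]/= -/N; clear -wb N28 mm_ss ss28 md1; lia.
      - by rewrite /= x6 y6.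
      - by [].
      rewrite [map _ _]/= [map _ [:: x; y]]/= xs yd -/N sE.
      apply: runs_opnd => //; rewrite -?sE //.
      + by clear -wb N28; lia.
      by clear -wb k28 ss28 side_ss k2_28 k_lt s0; lia.
    by rewrite /body_space -addnA leq_addr.
  have lowA l : l.1 < z -> uA l = None.
    by move=> lz; rewrite /uA block_upd_out // neq_ltn lz.
  have lowB l : l.1 < z -> uB l = None.
    by move=> lz; rewrite /uB block_upd_out // neq_ltn (ltn_trans lz).
  have rdn_in x y : x || rdn 3 y -> [|| x, rdn 3 y | false] by rewrite orbF.
  rewrite (_ : smults d f g = [::] ++ ([::] ++ (smults d f g ++ [::]))); last by rewrite cats0.
  pose wO := 350 * (7 ^ k * 4 ^ d) + 20.
  pose wM := 7 ^ k * (W + 124) + 23; pose spM := mul_loop_span k e S + 23.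
  apply: (runs_le (wk' := wO + (wO + (wM + wO)))
    (sp' := spO + 20 + (spO + 20 + (spM + (spO + 20)))) (sc' := body_space)); last first.
  - exact: leqnn.
  - by rewrite /step_span -/d /spM /spO; lia.
  - by rewrite /step_work -/d /wM /wO; lia.
  apply: (runs_seq (u1 := uA)).
    apply: runs_weaken (rO 0 3 2 a z f h3 _ _ _ _ _ _ _ _ _) _ _ _ _ _ => //.
    + by move=> i j iS jS; rewrite ld3 lda.
    + by rewrite sz3 ltnW // ltnW // ltnW.
    + by rewrite neq_ltn az orbT.
    + by have := szN 0 isT; rewrite addn0 => ->.
    + by move=> l la; rewrite /rdn la orbT.
  move=> h4 sh4 ld4.
  apply: (runs_seq (u1 := uB)).
    apply: runs_weaken (rO 1 4 1 b z.+1 g h4 _ _ _ _ _ _ _ _ _) _ _ _ _ _ => //.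
    + by move=> i j iS jS; rewrite ld4 /ovr lowA // ld3 ldb.
    + by rewrite (shape_size sh4) sz3 ltnW // ltnW // ltnW.
    + by rewrite neq_ltn ltnS (ltnW bz) orbT.
    + by have := szN 1 isT; rewrite addn1 sh4 => ->.
    + by move=> l lb; rewrite /rdn lb !orbT.
  move=> h5 sh5 ld5.
  have ld5' l : load h5 l = ovr uB (ovr uA (load h3)) l by rewrite ld5 /ovr ld4.
  apply: (runs_seq (u1 := uP)).
    apply: (runs_weaken (rd' := fun l => (l.1 == z) || (l.1 == z.+1)) (u' := uP)
        (wk' := wM) (sp' := spM)
        (sc' := if d <= cut then C else 7 ^ k * C)).
    * apply: runs_if; [by []|by []|by rewrite /wM /=; lia|by rewrite /spM /=; lia|].
      rewrite [den _ _ <= _]/=.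
      have := @runs_mul_loop k e W S C z z.+1 z.+2 h5 f g IH k0 _ _ _ _ _ _.
      rewrite -/d -/m -/N -/uP => run.
      have {run}: runs P w [:: 0; 7 ^ k; e; m; cut] [:: z; z.+1; z.+2] h5
         (if d <= cut then loop Seq p_mulser 3 3 mul_body
          else loop Par p_mulpar 3 3 mul_body) uP
         (fun l => (l.1 == z) || (l.1 == z.+1)) (smults d f g)
         (7 ^ k * (W + 124)) (mul_loop_span k e S) (if d <= cut then C else 7 ^ k * C).
        apply: run.
        -- by clear -wb; lia.
        -- move=> s i j s7 im jm; rewrite ld5' /ovr /uB block_upd_out; last first.
             by rewrite neq_ltn ltnSn.
           rewrite /uA -[s * _ + _]add0n block_upd_in; last exact: index_lt.
           by rewrite /vX index_div2 // index_divmod // index_mod2.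
        -- move=> s i j s7 im jm; rewrite ld5' /ovr /uB -[s * _ + _]add0n block_upd_in.
             by rewrite /vX index_div2 // index_divmod // index_mod2.
           exact: index_lt.
        -- by rewrite neq_ltn [z < _]ltnW ?orbT.
        -- by rewrite neq_ltn ltnSn orbT.
        -- by have := szN 2 isT; rewrite addn2 sh5 sh4 => ->.
      have bd1 : costs [:: Cst 0; Var 1; Var 4 [-] Var 3; Var 0; Var 6] + 3 < 20 by [].
      have sf : all (safe w env) [:: Cst 0; Var 1; Var 4 [-] Var 3; Var 0; Var 6].
        by rewrite /=; clear -wb ss28 side_ss d_lt; lia.
      case: ifP => _ run.
        apply: runs_le (runs_call_add (P := P) (aenv := aenv)
          (xs := [:: 2; 1; 0]) (p := p_mulser)
          (c := loop Seq p_mulser 3 3 mul_body) erefl sf isT bd1 _) _ _ _.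
        -- by rewrite [map _ _]/= [map _ [:: 2; 1; 0]]/= dkE; exact: run.
        -- by rewrite /wM /=; lia.
        -- by rewrite /spM /=; lia.
        exact: leqnn.
      apply: runs_le (runs_call_add (P := P) (aenv := aenv)
          (xs := [:: 2; 1; 0]) (p := p_mulpar)
        (c := loop Par p_mulpar 3 3 mul_body) erefl sf isT bd1 _) _ _ _.
      -- by rewrite [map _ _]/= [map _ [:: 2; 1; 0]]/= dkE; exact: run.
      -- by rewrite /wM /=; lia.
      -- by rewrite /spM /=; lia.
      exact: leqnn.
    * by [].
    * move=> l /orP[]/eqP lz; rewrite /rdn lz; apply/orP; right; apply/orP; left.
        by rewrite leqnn addn3 ltnS ltnW // !orbT.
      by rewrite leqnSn addn3 !ltnS leqnSn !orbT.
    * exact: leqnn.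
    * exact: leqnn.
    by rewrite /body_space leq_addl.
  move=> h6 sh6 ld6.
      apply: (runs_weaken (rd' := fun l => l.1 == z.+2) (u' := uC)
        (wk' := side * side * (ent_work k + 150) + 20) (sp' := spO + 20)
        (sc' := side * side * ent_space k)).
      * apply: (runs_call_add (P := P) (p := p_comb)
          (c := loop Par p_comb 4 2 comb_body) erefl).
        -- rewrite [all _ _]/=; clear -wb ss28; lia.
        -- by [].
        -- by [].
        rewrite [map _ _]/= [map _ [:: 0; 5]]/=.
        have := @runs_comb R w k m off z.+2 c h6 (fun s => mmul m (operands rowsA k s m f)
          (operands rowsB k s m g)) (3 * d) m0.
        rewrite -sE' => run; apply: runs_weaken (run ss8 _ _ _ _ _) _ _ _ _ _.
        ++ by clear -wb k28 N28 ss28 side_ss k2_28 k_lt s0; rewrite -/N; lia.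
        ++ move=> s i j s7 im jm; rewrite ld6 /ovr /uP -[_ + (_ + _)]add0n block_upd_in.
             by rewrite index_div2 // index_divmod // index_mod2.
           exact: index_lt.
        ++ by rewrite (shape_size sh6) (shape_size sh5) (shape_size sh4) sz3.
        ++ by rewrite neq_ltn (ltn_trans cz (ltnW (leqnn z.+2))).
        ++ by rewrite sh6 sh5 sh4 szC.
        ++ apply: eq_block_upd => o oss.
           have os : o %/ side < side by rewrite ltn_divLR.
           rewrite (combines_mmul (K := k) (f := f) (g := g)) //; rewrite -?sE' ?ltn_mod //.
             by rewrite subnn.
           by rewrite expn_gt0.
        ++ by move=> l ->; rewrite orbT.
        ++ exact: leqnn.
        ++ exact: leqnn.
        exact: leqnn.
      * by [].
      * move=> l /eqP lz; have r3 : rdn 3 l by rewrite /rdn lz; apply/or3P/Or33; lia.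
        by rewrite r3 !orbT.
      * exact: budgetS.
      * exact: leqnn.
      by rewrite /body_space addnAC leq_addl.
have phi0 : N <= 7 ^ k * 4 ^ d by rewrite -phiE leq_pmulr.
have spaceN : N * ent_space k <= 2 * (7 ^ k * 4 ^ d).
  rewrite -phiE mulnCA leq_mul2l /ent_space leq_subr orbT //.
have spaceS : side * side * ent_space k <= 2 * (7 ^ k * 4 ^ d).
  rewrite (leq_trans _ (leq_mul (leqnn 2) ss_phi)) // mulnCA leq_mul2l.
  by rewrite /ent_space leq_subr orbT.
have spC : 3 * N + body_space <= step_space k e C.
  by rewrite /step_space /body_space -/d; lia.
have Nw : N < w by clear -wb N28; lia.
have mmw : m * m < w by clear -wb ss28 mm_ss; lia.
have w120 : 120 <= step_work k e W by rewrite /step_work; lia.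
have s120 : 120 <= step_span k e S by rewrite /step_span; lia.
apply: runs_let.
- by rewrite [safe _ _ _]/= -/side divE; clear -wb ss28 side_ss m_side; lia.
- by rewrite /=; lia.
- by rewrite /=; lia.
rewrite [den _ _]/= -/side divE.
(* The updates visible with one and with two temporary blocks live: each release removes the update
   of its own block. *)
pose V1 := ovr uC uA; pose V2 := ovr (ovr uC uB) uA.
have safeN : safe w [:: m; 7 ^ k; 2 ^ k; k; d; side; cut; off] (Var 1 [*] (Var 0 [*] Var 0)).
  by rewrite /= mmw Nw.
have rdn_pred n l : l.1 != z + n -> rdn n.+1 l -> rdn n l.
  rewrite /rdn => /eqP lz /or3P[->|->|lz']; rewrite ?orbT //.
  apply/or3P/Or33; move: lz' lz; rewrite addnS ltnS => /andP[-> le] /eqP ne.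
  by rewrite ltn_neqAle ne.
have midC n l : l.1 = z + n -> uC l = None.
  by move=> lz; rewrite /uC block_upd_out // lz neq_ltn ltn_addr ?cz ?orbT.
apply: (runs_new (rd' := rdn 1) (v := V1)) => //; first by rewrite /=; lia.
- by rewrite /=; lia.
- by rewrite [den _ _]/=; lia.
- move=> h1 sh1 ld1; have sz1 : size h1 = z.+1.
    by rewrite -(size_map size) -/(shape h1) sh1 size_rcons size_map.
  apply: (runs_new (rd' := rdn 2) (v := V2)) => //; first by rewrite /=; lia.
  + by rewrite /=; lia.
  + by rewrite [den _ _]/=; lia.
  + move=> h2 sh2 ld2; have sz2 : size h2 = z.+2.
      by rewrite -(size_map size) -/(shape h2) sh2 size_rcons size_map sz1.
    apply: (runs_new (rd' := rdn 3) (v := ovr (ovr (ovr uC uP) uB) uA)) => //.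
    * by rewrite /=; lia.
    * by rewrite /=; lia.
    * by rewrite [den _ _]/=; lia.
    * move=> h3 sh3 ld3; rewrite sz1 sz2; apply: runs_le (body h3 _ _) _ _ _.
      -- by rewrite sh3 sh2 sh1.
      -- by move=> l; rewrite ld3 ld2 ld1.
      -- by rewrite /=; lia.
      -- by rewrite /=; lia.
      by rewrite [den _ _]/=; lia.
    * by move=> l; rewrite sz2 => lz; rewrite /V2 /ovr /uP block_upd_out //; case: (uC l).
    * move=> l; rewrite sz2 => lz; rewrite /V2 /ovr (midC 2) ?addn2 // /uB.
      by rewrite /uA !(out _ _ _ _ _ _ lz) //; lia.
    by move=> l; rewrite sz2 -[z.+2]addn2 => lz /(rdn_pred 2 _ lz)->; rewrite orbT.
  + by move=> l; rewrite sz1 => lz; rewrite /V1 /V2 /ovr /uB block_upd_out //; case: (uC l).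
  + move=> l; rewrite sz1 => lz; rewrite /V1 /ovr (midC 1) ?addn1 //.
    by rewrite /uA !(out _ _ _ _ _ _ lz) //; lia.
  by move=> l; rewrite sz1 -[z.+1]addn1 => lz /(rdn_pred 1 _ lz)->; rewrite orbT.
- move=> l lz; rewrite /V1 /ovr /uA block_upd_out //; by case: (uC l).
- by move=> l lz; rewrite (midC 0) ?addn0.
move=> l lz /or3P[->|->|lz']; rewrite ?orbT //.
by move: lz lz'; rewrite -/z; lia.
Qed.

End Mul.

Section MulRec.
Variables (R : pzRingType) (w cut : nat).
Notation P := strassen_procs.

(** A tail call inherits the effect of its target, so computing [7 ^ k] and [2 ^ k] only adds [O(k)]
    to the work and span of [step_proc]. *)
Lemma runs_pow k kk d side off a b c (h : heap R) u rd ms wk sp sc :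
    kk <= k -> 10 + 7 ^ k + 2 ^ k + k < w ->
    runs P w [:: 7 ^ k; 2 ^ k; k; d; side; cut; off] [:: a; b; c] h step_proc
      u rd ms wk sp sc ->
  runs P w [:: kk; 7 ^ (k - kk); 2 ^ (k - kk); k; d; side; cut; off] [:: a; b; c] h
    pow_proc u rd ms (wk + (25 * kk + 20)) (sp + (25 * kk + 20)) sc.
Proof.
move=> kkk wb run; elim: kk kkk => [|kk IH] kkk.
  apply: runs_if; [by []|by rewrite /=; lia|by rewrite /=; lia|by rewrite /=; lia|].
  rewrite [den _ _ <= _]/= subn0.
  apply: runs_le; first apply: (runs_call_add (P := P) (p := p_step) (K := 15)
    (c := step_proc) erefl).
  - by rewrite /=; lia.
- by [].
- by [].
  - exact: run.
  - by rewrite /=; lia.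
  - by rewrite /=; lia.
  exact: leqnn.
apply: runs_if; [by []|by rewrite /=; lia|by rewrite /=; lia|by rewrite /=; lia|].
rewrite [den _ _ <= _]/=.
have kE : k - kk = (k - kk.+1).+1 by lia.
have e7 : 7 ^ (k - kk) = 7 * 7 ^ (k - kk.+1) by rewrite kE expnS.
have e2 : 2 ^ (k - kk) = 2 * 2 ^ (k - kk.+1) by rewrite kE expnS.
have l7 : 7 ^ (k - kk) <= 7 ^ k by rewrite leq_exp2l ?leq_subr.
have l2 : 2 ^ (k - kk) <= 2 ^ k by rewrite leq_exp2l ?leq_subr.
apply: runs_le; first apply: (runs_call_add (P := P) (p := p_pow) (K := 20)
  (c := pow_proc) erefl).
- by rewrite /= -e7 -e2; clear -l7 l2 wb kkk; lia.
- by [].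
- by [].
- rewrite [map _ _]/= [map _ [:: 0; 1; 2]]/= -e7 -e2 subn1 /=.
  by apply: IH; exact: ltnW.
- by rewrite /=; lia.
- by rewrite /=; lia.
exact: leqnn.
Qed.

Lemma mul_ok0 : 2 < w -> mul_ok R w cut 0 20 20 0.
Proof.
move=> w2 off a b c h f g wb lda ldb nca ncb szc.
apply: runs_if => //=; first by lia.
have := lda 0 0 isT isT; have := ldb 0 0 isT isT; rewrite !addn0 => lb la.
have run : runs P w [:: 0; 1; cut; off] [:: a; b; c] h
    (Arith RMul (Cell 2 (Var 3)) (Cell 0 (Var 3)) (Cell 1 (Var 3)))
    (cell_upd (c, off) (f 0 0 * g 0 0)%R) (fun l => (l.1 == a) || (l.1 == b))
    [:: (f 0 0, g 0 0)] 17 17 0.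
  apply: (@runs_arith R P w _ _ h RMul _ _ _ (c, off) (f 0 0) (g 0 0)) => //=;
    rewrite ?eqxx ?orbT //.
  by rewrite validE /=; apply: leq_trans szc; rewrite addn1.
apply: runs_weaken run _ _ _ _ _ => //.
- move=> l; rewrite -(addn0 off) -{1}(muln1 0).
  have := @block_upd1 R c off 0 (fun o => mmul 1 f g (o %/ 1) (o %% 1)) l.
  rewrite muln1 addn0 => ->; rewrite /cell_upd; case: ifP => // _.
  by rewrite /mmul big_ord1.
by move=> l ->; rewrite orbT.
Qed.

Lemma mul_ok_step k e W S C : 0 < k -> k = (k + e + 4) %/ 5 -> 200 < w ->
  mul_ok R w cut e W S C ->
  mul_ok R w cut (k + e) (step_work k e W + (25 * k + 50))
    (step_span cut k e S + (25 * k + 50)) (step_space cut k e C).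
Proof.
move=> k0 kE w20 IH off a b c h f g wb lda ldb nca ncb szc.
have k28 : 7 ^ k <= 28 ^ (k + e).
  by rewrite (expnD _ k) -[7 ^ k]muln1 leq_mul ?expn_gt0 ?leq_expl.
have k2_28 : 2 ^ k <= 7 ^ k by rewrite leq_expl.
have d_lt : k + e < 28 ^ (k + e) by rewrite ltn_expl.
apply: runs_if; [by []|by rewrite /=; lia|by rewrite /=; lia|by rewrite /=; lia|].
rewrite [den _ _ <= _]/= ifF; last by lia.
apply: runs_let; [|by rewrite /=; lia|by rewrite /=; lia|].
  by rewrite /=; clear -wb d_lt w20; lia.
rewrite [den _ _]/= -kE.
have run := @runs_pow k k (k + e) (2 ^ (k + e)) off a b c h _ _ _ _ _ _ (leqnn k) _
  (runs_step IH k0 wb lda ldb nca ncb szc).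
rewrite subnn !expn0 in run.
apply: runs_le; first apply: (runs_call_add (P := P) (p := p_pow) (K := 20)
  (c := pow_proc) erefl).
- by rewrite /=; lia.
- by [].
- by [].
- rewrite [map _ _]/= [map _ [:: 0; 1; 2]]/=; apply: run.
  by clear -wb k28 k2_28 d_lt w20; lia.
- by rewrite /=; lia.
- by rewrite /=; lia.
exact: leqnn.
Qed.

(* [7 * 4 ^ 5 <= 6 ^ 5], five sizes at a time. *)
Lemma phi_le d : 7 ^ ((d + 4) %/ 5) * 4 ^ d <= 5 * 6 ^ d.
Proof.
elim/ltn_ind: d => d IH; case: (ltnP d 5) => d5.
  (* The factor 5 comes from these cases: at [d = 1] the inequality reads 28 against [5 * 6]. *)
  by move: d d5 {IH}; do 5?[case=> //].
have {}IH := IH (d - 5) ltac:(lia).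
have -> : (d + 4) %/ 5 = ((d - 5 + 4) %/ 5).+1 by lia.
have -> : d = (d - 5) + 5 by lia.
move: (d - 5) IH => x; rewrite expnS !expnD.
rewrite addnK; move: (7 ^ _) (4 ^ x) (6 ^ x) => X Y Z; lia.
Qed.

(* The subtracted multiples of [6 ^ d] absorb the cost of one unrolling step, as
   [7 ^ k * 6 ^ (d - k) >= 7 / 6 * 6 ^ d]. In [mul_space], serial products have
   size at least [x]. *)
Definition mul_work d := 46 * 1000 * 7 ^ d - 45 * 1000 * 6 ^ d.
Definition mul_span d := 11 * 1000 * d + 46 * 1000 * 7 ^ cut.
Definition mul_space d :=
  let x := 4 * cut %/ 5 in
  if d <= cut then 42 * 6 ^ d else 252 * 7 ^ d * 6 ^ x %/ 7 ^ x - 210 * 6 ^ d.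

Lemma pow67 k e : 0 < k -> 7 * 6 ^ (k + e) <= 6 * (7 ^ k * 6 ^ e).
Proof.
case: k => // k _; rewrite addSn expnS [7 ^ _]expnS expnD.
have : 6 ^ k * 6 ^ e <= 7 ^ k * 6 ^ e by rewrite leq_mul2r leq_expl ?orbT.
lia.
Qed.

Lemma pow67_le x d : x <= d -> 6 ^ d <= 7 ^ d * 6 ^ x %/ 7 ^ x.
Proof.
move=> xd; rewrite leq_divRL ?expn_gt0 //.
have -> : d = (d - x) + x by lia.
rewrite !expnD -!mulnA [6 ^ x * _]mulnC leq_mul2r leq_expl //; exact: orbT.
Qed.

Lemma muln_sub_comb a b p x y z : p * x = z ->
  p * (a * x - b * y) = a * z - b * (p * y).
Proof. by move=> <-; rewrite mulnBr !(mulnCA p). Qed.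

(** * The recurrences for work, span and space *)

Section Bounds.
Variables k e : nat.
Hypotheses (k0 : 0 < k) (kE : k = (k + e + 4) %/ 5).
Let d := k + e.
Let phi6 : 7 ^ k * 4 ^ d <= 5 * 6 ^ d.
Proof. by have := phi_le d; rewrite -kE. Qed.

Lemma mul_work_step : step_work k e (mul_work e) + (25 * k + 50) <= mul_work d.
Proof.
have p7 : 7 ^ k <= 7 ^ k * 4 ^ d by rewrite leq_pmulr ?expn_gt0.
have p0 : 0 < 7 ^ k by rewrite expn_gt0.
have pk : k < 7 ^ k by rewrite ltn_expl.
(* This gains [45 * 1000 / 6 = 7500] copies of [6 ^ d], while the entry loops cost [5 * 1050 = 5250]
   copies and the remaining terms fit into the difference. *)
have q := pow67 e k0; rewrite -/d in q.
have E : 7 ^ k * 7 ^ e = 7 ^ d by rewrite -expnD.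
have l67 : 6 ^ e <= 7 ^ e by rewrite leq_expl.
have l6 : 7 ^ k * 6 ^ e <= 7 ^ d by rewrite -E leq_mul2l l67 orbT.
have M : 7 ^ k * mul_work e = _ := muln_sub_comb (46 * 1000) (45 * 1000) (6 ^ e) E.
have D : mul_work d = 46 * 1000 * 7 ^ d - 45 * 1000 * 6 ^ d by [].
move: (mul_work d) (mul_work e) M D => W' W M D.
rewrite /step_work -/d; have := phi6.
by clear -M D l6 q p7 p0 pk; lia.
Qed.

Lemma mul_span_step : cut < d -> step_span cut k e (mul_span e) + (25 * k + 50) <= mul_span d.
Proof.
move=> cd; rewrite /step_span /mul_span /mul_loop_span -/d ifF; last by lia.
rewrite /ent_span; have dE : d = k + e by [].
by clearbody d; clear -kE dE k0; lia.
Qed.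

Lemma mul_space_step : step_space cut k e (mul_space e) <= mul_space d.
Proof.
have q := pow67 e k0; rewrite -/d in q.
have ed : e < d by rewrite /d; lia.
rewrite /step_space /mul_space -/d; case: (leqP d cut) => [dc|cd].
  (* In units of [6 ^ d], a step costs [7 * 5 = 35] and one subproduct at most [42 / 6 = 7],
     together 42. *)
  rewrite (leq_trans (ltnW ed) dc).
  have : 6 * 6 ^ e <= 6 ^ d by rewrite -expnS leq_exp2l.
  lia.
set x := 4 * cut %/ 5.
(* Here [e] is [4 * d / 5] rounded down, and [cut < d]. *)
have xe : x <= e by rewrite /x; clear -kE cd; subst d; lia.
have P1 := pow67_le xe; have P2 := pow67_le (leq_trans xe (ltnW ed)).
have F : forall y, 252 * 7 ^ y * 6 ^ x %/ 7 ^ x >= 252 * (7 ^ y * 6 ^ x %/ 7 ^ x).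
  move=> y; rewrite leq_divRL ?expn_gt0 // -mulnA -[_ * 7 ^ y * _]mulnA leq_mul2l.
  by rewrite leq_trunc_div.
have F1 := F e; have F2 := F d.
have G : 7 ^ k * (252 * 7 ^ e * 6 ^ x %/ 7 ^ x) <= 252 * 7 ^ d * 6 ^ x %/ 7 ^ x.
  rewrite leq_divRL ?expn_gt0 // -mulnA.
  apply: leq_trans (leq_mul (leqnn _) (leq_trunc_div _ _)) _.
  by rewrite /d expnD; apply: eq_leq; lia.
(* The parallel formula also covers serial subproducts, because [252 = 42 + 210] and
   [6 ^ e <= 7 ^ e * 6 ^ x %/ 7 ^ x]. The 210 is the fixed point of [210 * 7 / 6 - 35]. *)
have Ce : (if e <= cut then 42 * 6 ^ e else 252 * 7 ^ e * 6 ^ x %/ 7 ^ x - 210 * 6 ^ e)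
    <= 252 * 7 ^ e * 6 ^ x %/ 7 ^ x - 210 * 6 ^ e.
  by case: ifP => // _; lia.
have := leq_mul (leqnn (7 ^ k)) Ce; rewrite mulnBr.
move: (7 ^ k * (if _ then _ else _)) => T.
rewrite (mulnCA (7 ^ k) 210).
have : 210 * (7 ^ k * 6 ^ e) <= 7 ^ k * (252 * 7 ^ e * 6 ^ x %/ 7 ^ x).
  rewrite mulnCA leq_mul2l; apply/orP; right; lia.
have := phi6; clear -G F2 P2 q; lia.
Qed.

End Bounds.

Lemma mul_correct d : 200 < w ->
  mul_ok R w cut d (mul_work d) (mul_span d) (mul_space d).
Proof.
move=> w2; elim/ltn_ind: d => d IH; case: (posnP d) => [d0|d0].
  rewrite d0; have [W S C] : [/\ 20 <= mul_work 0, 20 <= mul_span 0 & 0 <= mul_space 0].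
    split=> //; rewrite /mul_span; have : 0 < 7 ^ cut by rewrite expn_gt0.
    by lia.
  move=> off a b c h f g wb lda ldb nca ncb szc.
  apply: runs_le W S C; apply: mul_ok0 => //; lia.
pose k := (d + 4) %/ 5; pose e := d - k.
have dE : d = k + e by rewrite /e /k; lia.
have k0 : 0 < k by rewrite /k; lia.
have kE : k = (k + e + 4) %/ 5 by rewrite -dE.
have IHe := mul_ok_step k0 kE w2 (IH e ltac:(lia)).
have wS := mul_work_step k0 kE; have spS := mul_span_step k0 kE.
have scS := mul_space_step k0 kE.
rewrite -dE in IHe wS spS scS.
move=> off a b c h f g wb lda ldb nca ncb szc.
have run := IHe off a b c h f g wb lda ldb nca ncb szc.
(* A serial product has span at most its work, which the constant term [46 * 1000 * 7 ^ cut] of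
   [mul_span] covers. *)
case: (leqP d cut) => dc; last by apply: runs_le run wS (spS dc) scS.
have wS' := wS; apply: runs_le (runs_span_work run) wS' _ scS.
apply: leq_trans (geq_minr _ _) _; apply: leq_trans wS _.
rewrite /mul_work /mul_span (leq_trans (leq_subr _ _)) // (leq_trans _ (leq_addl _ _)) //.
by rewrite leq_mul2l leq_exp2l // dc orbT.
Qed.

End MulRec.

(** * Padding and the main program *)

Section Padding.
Variables (R : pzRingType) (w : nat).
Notation P := strassen_procs.

Definition mx_fun n (A : 'M[R]_n) (i j : nat) : R :=
  match insub i : option 'I_n, insub j : option 'I_n with
  | Some i', Some j' => A i' j'
  | _, _ => 0%R
  end.

Lemma pad_to_mx d n (A : 'M[R]_n) : pad d A = to_mx (pow2 d) (mx_fun A).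
Proof. by []. Qed.

Lemma mx_fun_ord n (A : 'M[R]_n) (i j : 'I_n) : mx_fun A i j = A i j.
Proof. by rewrite /mx_fun !valK. Qed.

Lemma mx_fun_out n (A : 'M[R]_n) i j : (n <= i) || (n <= j) -> mx_fun A i j = 0%R.
Proof.
rewrite /mx_fun; case: insubP => [i' _ <-|//]; case: insubP => [j' _ <-|//].
by rewrite [n <= i']leqNgt [n <= j']leqNgt !ltn_ord.
Qed.

(** The summands with index at least [n] vanish, since the padding is zero. *)
Lemma mmul_mx_fun n m (A B : 'M[R]_n) i j : n <= m -> i < n -> j < n ->
  mmul m (mx_fun A) (mx_fun B) i j = mx_fun (A *m B)%R i j.
Proof.
move=> nm ni nj; rewrite -[i]/(val (Ordinal ni)) -[j]/(val (Ordinal nj)) mx_fun_ord mxE.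
rewrite /mmul (bigID (fun l : 'I_m => l < n)) /= [X in (_ + X)%R]big1 ?addr0 => [|l].
  rewrite -(big_ord_widen _ (fun l => mx_fun A i l * mx_fun B l j)%R nm).
  apply: eq_bigr => l _.
  by rewrite -[i]/(val (Ordinal ni)) -[j]/(val (Ordinal nj)) !mx_fun_ord.
by rewrite -leqNgt => nl; rewrite mx_fun_out ?nl ?orbT // mul0r.
Qed.

Lemma row_majorE n (A : 'M[R]_n) :
  row_major A = mkseq (fun o => Some (mx_fun A (o %/ n) (o %% n))) (n * n).
Proof.
have -> : row_major A = [seq Some (mx_fun A i j) | i <- iota 0 n, j <- iota 0 n].
  rewrite -val_enum_ord allpairs_mapl allpairs_mapr /row_major.
  by apply: eq_allpairs => i j; rewrite mx_fun_ord.
rewrite /mkseq /= iota_mul map_flatten -map_comp; congr flatten; apply: eq_map => i /=.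
rewrite -[i * n]addn0 iotaDl -map_comp; apply/eq_in_map => j; rewrite mem_iota => jn /=.
by rewrite index_div ?index_mod.
Qed.

Lemma load_row_major n (A : 'M[R]_n) (h : heap R) b i j :
  nth [::] h b = row_major A -> i < n -> j < n ->
  load h (b, i * n + j) = Some (mx_fun A i j).
Proof.
move=> hb ni nj; rewrite /load hb row_majorE nth_mkseq ?index_div ?index_mod //.
by have := @index_lt 1 n 0 i j isT ni nj; rewrite mul1n.
Qed.

Lemma runs_pad n d b bd (h : heap R) (A : 'M[R]_n) :
    200 + 100 * 28 ^ d < w -> n <= 2 ^ d ->
    (forall i j, i < n -> j < n -> load h (b, i * n + j) = Some (mx_fun A i j)) ->
    bd != b -> 2 ^ d * 2 ^ d <= nth 0 (shape h) bd ->
  runs P w [:: 0; 2 ^ d * 2 ^ d; n; 2 ^ d] [:: b; bd] h (loop Par p_pad 2 2 pad_body)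
    (block_upd bd 0 (2 ^ d * 2 ^ d) (fun o => mx_fun A (o %/ 2 ^ d) (o %% 2 ^ d)))
    (fun l => l.1 == b) [::] (130 * (2 ^ d * 2 ^ d)) (200 * d.+1) 0.
Proof.
move=> wb nd ld nbd szd.
set side := 2 ^ d; set v := fun o => _.
have s0 : 0 < side by rewrite expn_gt0.
have ss28 : side * side <= 28 ^ d by rewrite -expnMn leq_expl.
have s_ss : side <= side * side by rewrite leq_pmulr.
have body i (h1 : heap R) : i < side * side -> shape h1 = shape h ->
   (forall l, l.1 != bd -> load h1 l = load h l) ->
   runs P w [:: i; 1; n; side] [:: b; bd] h1 pad_body
     (block_upd bd (0 + i * 1) 1 (fun o => v (i * 1 + o))) (fun l => l.1 == b)
     [::] 30 30 0.
  move=> iN sh1 ld1.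
  have i1 : i %/ side * side <= i := leq_trunc_div i side.
  have jE : i - i %/ side * side = i %% side by rewrite {1}(divn_eq i side) addKn.
  have im : i %/ side <= i := leq_div i side.
  have vd : valid h1 (bd, i) by rewrite validE sh1 /=; apply: leq_trans szd.
  apply: (@runs_weaken _ _ _ _ _ _ _ _ _ _ _ _ _ (cell_upd (bd, i) (v i))
    (fun l => l.1 == b) 30 30 0) => //.
  - apply: runs_let; [by rewrite /=; lia|by []|by []|].
    rewrite [den _ _]/=; apply: runs_let; [by rewrite /=; lia|by []|by []|].
    rewrite [den _ _]/= jE.
    apply: runs_if; [by []|by []|by []|by []|]; rewrite [den _ _ <= _]/=.
    case: ifP => ni.
      have -> : v i = 0%R by rewrite /v mx_fun_out // ni.
      exact: runs_zero.
    apply: runs_if; [by []|by []|by []|by []|]; rewrite [den _ _ <= _]/=.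
    case: ifP => nj.
      have -> : v i = 0%R by rewrite /v mx_fun_out // nj orbT.
      exact: runs_zero.
    have idn : i %/ side < n by rewrite ltnNge ni.
    have jdn : i %% side < n by rewrite ltnNge nj.
    have ad : i %/ side * n + i %% side < side * side.
      have := @index_lt 1 n 0 _ _ isT idn jdn; rewrite mul1n => /leq_trans; apply.
      by rewrite leq_mul.
    apply: runs_move => //=.
    + by apply/andP; lia.
    + by rewrite ld1 ?ld //= eq_sym.
  - by move=> l; rewrite (block_upd1 _ 0 _ v).
  by move=> l ->; rewrite orbT.
have H := @runs_block_loop R P w p_pad true pad_body [:: n; side] [:: b; bd]
  h bd 0 (side * side) 1 v (fun l => l.1 == b) (fun=> [::]) 30 30 0 (2 * d)
  erefl _ _ _ _ isT body.
rewrite muln1 flatten_nil in H.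
apply: runs_le (H _ _ _ _) _ _ _.
- by rewrite muln_gt0 s0 /= expnM -expnMn leq_expl.
- by lia.
- by lia.
- by move=> l /eqP->; rewrite eq_sym.
- by rewrite mulnC leq_mul2r orbT.
- by rewrite /loop_overhead /=; lia.
by rewrite muln0.
Qed.

Lemma runs_unpad n d b c (h : heap R) p :
    200 + 100 * 28 ^ d < w -> 0 < n -> n <= 2 ^ d ->
    (forall i j, i < n -> j < n -> load h (b, i * 2 ^ d + j) = Some (p i j)) ->
    c != b -> n * n <= nth 0 (shape h) c ->
  runs P w [:: 0; n * n; n; 2 ^ d] [:: b; c] h (loop Par p_unpad 2 2 unpad_body)
    (block_upd c 0 (n * n) (fun o => p (o %/ n) (o %% n)))
    (fun l => l.1 == b) [::] (130 * (2 ^ d * 2 ^ d)) (200 * d.+1) 0.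
Proof.
move=> wb n0 nd ld nbd szd.
set side := 2 ^ d; set v := fun o => _.
have s0 : 0 < side by rewrite expn_gt0.
have ss28 : side * side <= 28 ^ d by rewrite -expnMn leq_expl.
have s_ss : side <= side * side by rewrite leq_pmulr.
have nn_ss : n * n <= side * side by rewrite leq_mul.
have body i (h1 : heap R) : i < n * n -> shape h1 = shape h ->
   (forall l, l.1 != c -> load h1 l = load h l) ->
   runs P w [:: i; 1; n; side] [:: b; c] h1 unpad_body
     (block_upd c (0 + i * 1) 1 (fun o => v (i * 1 + o))) (fun l => l.1 == b)
     [::] 30 30 0.
  move=> iN sh1 ld1.
  have i1 : i %/ n * n <= i := leq_trunc_div i n.
  have jE : i - i %/ n * n = i %% n by rewrite {1}(divn_eq i n) addKn.
  have im : i %/ n <= i := leq_div i n.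
  have vd : valid h1 (c, i) by rewrite validE sh1 /=; apply: leq_trans szd.
  have idn : i %/ n < n by rewrite ltn_divLR.
  have jdn : i %% n < n by rewrite ltn_mod.
  have ad : i %/ n * side + i %% n < side * side.
    have := @index_lt 1 side 0 (i %/ n) (i %% n) isT.
    by rewrite mul1n; apply; apply: leq_trans nd.
  apply: (@runs_weaken _ _ _ _ _ _ _ _ _ _ _ _ _ (cell_upd (c, i) (v i))
    (fun l => l.1 == b) 30 30 0) => //.
  - apply: runs_move => //=.
    + rewrite jE; move: (i %/ n * n) (i %/ n * side) ad i1 => a1 a2.
      by clear -iN nn_ss ss28 wb im jdn nd s_ss; lia.
    + by rewrite jE ld1 ?ld //= eq_sym.
  - by move=> l; rewrite (block_upd1 _ 0 _ v).
  by move=> l ->; rewrite orbT.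
have H := @runs_block_loop R P w p_unpad true unpad_body [:: n; side] [:: b; c]
  h c 0 (n * n) 1 v (fun l => l.1 == b) (fun=> [::]) 30 30 0 (2 * d)
  erefl _ _ _ _ isT body.
rewrite muln1 flatten_nil in H.
apply: runs_le (H _ _ _ _) _ _ _.
- by rewrite muln_gt0 n0 (leq_trans nn_ss) // expnM -expnMn leq_expl.
- by lia.
- by lia.
- by move=> l /eqP->; rewrite eq_sym.
- by rewrite mulnC leq_mul //.
- by rewrite /loop_overhead /=; lia.
by rewrite muln0.
Qed.

End Padding.

(** * The execution of the whole program *)

Section Main.
Variables (R : pzRingType) (w n d : nat) (A B : 'M[R]_n).
Hypotheses (n0 : 0 < n) (nd : n <= 2 ^ d) (wb : 200 + 100 * 28 ^ d < w).
Notation P := strassen_procs.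
Let side := 2 ^ d.
Let h0 : heap R := [:: row_major A; row_major B; nseq (n * n) None].
Let uC := block_upd 2 0 (n * n) (fun o => mx_fun (A *m B)%R (o %/ n) (o %% n)).
Let ms := smults d (mx_fun A) (mx_fun B).

Lemma size_row_major (X : 'M[R]_n) : size (row_major X) = n * n.
Proof. by rewrite row_majorE size_mkseq. Qed.

(** Block numbers are concrete at this level: 0, 1, 2 are the given arrays, 3 and 4 the padded
    inputs, and 5 the padded product. *)
Lemma runs_main_body cut pw W S C (h : heap R) :
    mul_ok R w cut d W S C -> size h = 6 ->
    shape h = [:: n * n; n * n; n * n; side * side; side * side; side * side] ->
    load h =1 load h0 ->
  runs P w [:: cut; pw; d; side; n] [:: 5; 4; 3; 0; 1; 2] h main_body
    (ovr (ovr (ovr uC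
       (block_upd 5 0 (side * side) (fun o =>
          mmul side (mx_fun A) (mx_fun B) (o %/ side) (o %% side))))
       (block_upd 4 0 (side * side) (fun o => mx_fun B (o %/ side) (o %% side))))
       (block_upd 3 0 (side * side) (fun o => mx_fun A (o %/ side) (o %% side))))
    (fun l => l.1 != 2) ms
    (W + 390 * (side * side) + 80) (S + 600 * d.+1 + 80) C.
Proof.
move=> mulH szh shh ldh.
have s0 : 0 < side by rewrite expn_gt0.
have ss28 : side * side <= 28 ^ d by rewrite -expnMn leq_expl.
have s_ss : side <= side * side by rewrite leq_pmulr.
have nn_ss : n * n <= side * side by rewrite leq_mul.
have d_s : d < side by rewrite ltn_expl.
set uA := block_upd 3 _ _ _; set uB := block_upd 4 _ _ _; set uP := block_upd 5 _ _ _.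
set env := [:: cut; pw; d; side; n].
set aenv := [:: 5; 4; 3; 0; 1; 2].
have rP x y src dst (X : 'M[R]_n) (h' : heap R) : x < 6 -> y < 6 ->
    nth 0 aenv x = src -> nth 0 aenv y = dst ->
    (forall i j, i < n -> j < n -> load h' (src, i * n + j) = Some (mx_fun X i j)) ->
    dst != src -> side * side <= nth 0 (shape h') dst ->
    runs P w env aenv h' (Call p_pad [:: Cst 0; Var 3 [*] Var 3; Var 4; Var 3] [:: x; y])
     (block_upd dst 0 (side * side) (fun o => mx_fun X (o %/ side) (o %% side)))
     (fun l => l.1 == src) [::]
     (130 * (side * side) + 20) (200 * d.+1 + 20) C.
  move=> x6 y6 xs yd ld' nds szd'.
  apply: runs_le; first apply: (runs_call_add (P := P) (K := 20) (p := p_pad)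
    (c := loop Par p_pad 2 2 pad_body) erefl).
  - by rewrite /=; clear -wb ss28; lia.
  - by rewrite /= x6 y6.
  - by [].
  - rewrite [map _ _]/= [map _ [:: x; y]]/= xs yd.
    exact: runs_pad.
  - exact: leqnn.
  - exact: leqnn.
  by [].
rewrite (_ : ms = [::] ++ ([::] ++ (ms ++ [::]))); last by rewrite cats0.
apply: (runs_le (wk' := 130 * (side * side) + 20 + (130 * (side * side) + 20 +
    (W + 20 + (130 * (side * side) + 20))))
  (sp' := 200 * d.+1 + 20 + (200 * d.+1 + 20 + (S + 20 + (200 * d.+1 + 20)))) (sc' := C));
  last first.
- exact: leqnn.
- by lia.
- by lia.
apply: (runs_seq (u1 := uA)).
  apply: runs_weaken (rP 3 2 0 3 A h _ _ _ _ _ _ _) _ _ _ _ _ => //.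
  - by move=> i j iS jS; rewrite ldh; apply: load_row_major.
  - by rewrite shh.
  by move=> l /eqP->; rewrite orbT.
move=> h4 sh4 ld4.
apply: (runs_seq (u1 := uB)).
  apply: runs_weaken (rP 4 1 1 4 B h4 _ _ _ _ _ _ _) _ _ _ _ _ => //.
  - by move=> i j iS jS; rewrite ld4 /ovr /uA block_upd_out // ldh; apply: load_row_major.
  - by rewrite sh4 shh.
  by move=> l /eqP->; rewrite !orbT.
move=> h5 sh5 ld5.
have ld5' l : load h5 l = ovr uB (ovr uA (load h)) l by rewrite ld5 /ovr ld4.
have idx i j : i < side -> j < side -> i * side + j < side * side.
  by move=> iS jS; have := @index_lt 1 side 0 i j isT iS jS; rewrite mul1n.
apply: (runs_seq (u1 := uP)).
  apply: (runs_weaken (rd' := fun l => (l.1 == 3) || (l.1 == 4)) (u' := uP)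
    (wk' := W + 20) (sp' := S + 20) (sc' := C)).
  - apply: (runs_call_add (P := P) (p := p_mul) (c := mul_proc) erefl).
    + by rewrite /=; clear -wb; lia.
    + by [].
    + by [].
    rewrite [map _ _]/= [map _ [:: 2; 1; 0]]/=.
    apply: mulH => //.
    + by lia.
    + move=> i j iS jS; rewrite ld5' /ovr /uB block_upd_out // /uA block_upd_in ?idx //.
      by rewrite index_div ?index_mod.
    + move=> i j iS jS; rewrite ld5' /ovr /uB block_upd_in ?idx //.
      by rewrite index_div ?index_mod.
    by rewrite sh5 sh4 shh.
  - by [].
  - by move=> l /orP[]/eqP->; rewrite /= !orbT.
  - exact: leqnn.
  - exact: leqnn.
  exact: leqnn.
move=> h6 sh6 ld6.
apply: (runs_weaken (rd' := fun l => l.1 == 5)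
  (u' := block_upd 2 0 (n * n) (fun o =>
     mmul side (mx_fun A) (mx_fun B) (o %/ n) (o %% n)))
  (wk' := 130 * (side * side) + 20) (sp' := 200 * d.+1 + 20) (sc' := 0)).
- apply: (runs_call_add (P := P) (p := p_unpad) (c := loop Par p_unpad 2 2 unpad_body) erefl).
  + by rewrite /=; clear -wb ss28 nn_ss; lia.
  + by [].
  + by [].
  rewrite [map _ _]/= [map _ [:: 0; 5]]/=.
  apply: runs_unpad => //.
  + move=> i j ni nj; rewrite ld6 /ovr /uP -[_ * _ + _]add0n block_upd_in.
      by rewrite index_div ?index_mod //; apply: leq_trans nj nd.
    by apply: idx; [apply: leq_trans ni nd | apply: leq_trans nj nd].
  by rewrite sh6 sh5 sh4 shh.
- apply: eq_block_upd => o on.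
  by rewrite mmul_mx_fun ?ltn_mod // ltn_divLR.
- by move=> l /eqP->; rewrite /= !orbT.
- exact: leqnn.
- exact: leqnn.
by [].
Qed.

Lemma runs_cut_body cut pw W S C :
    mul_ok R w cut d W S C ->
  runs P w [:: cut; pw; d; side; n] [:: 0; 1; 2] h0
    (New (Var 3 [*] Var 3) (New (Var 3 [*] Var 3) (New (Var 3 [*] Var 3) main_body)))
    uC (fun l => l.1 != 2) ms
    (W + 390 * (side * side) + 110) (S + 600 * d.+1 + 110) (C + 3 * (side * side)).
Proof.
move=> mulH.
have ss28 : side * side <= 28 ^ d by rewrite -expnMn leq_expl.
set uP := block_upd 5 0 (side * side) (fun o =>
          mmul side (mx_fun A) (mx_fun B) (o %/ side) (o %% side)).
set uB := block_upd 4 0 (side * side) (fun o => mx_fun B (o %/ side) (o %% side)).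
set uA := block_upd 3 0 (side * side) (fun o => mx_fun A (o %/ side) (o %% side)).
have sf : safe w [:: cut; pw; d; side; n] (Var 3 [*] Var 3).
  by rewrite /=; clear -wb ss28; lia.
have sh0 : shape h0 = [:: n * n; n * n; n * n].
  by rewrite /h0 /shape /= !size_row_major size_nseq.
have none b l n1 n2 v : l.1 != b -> @block_upd R b n1 n2 v l = None.
  by move=> ?; rewrite block_upd_out.
have ov (u1 u2 : loc -> option R) l :
  ovr u1 u2 l = if u1 l is Some v then Some v else u2 l by [].
apply: (runs_new (rd' := fun l => l.1 != 2) (v := ovr uC uA)) => //.
  by rewrite /=; lia.
- by rewrite /=; lia.
- by rewrite [den _ _]/=; lia.
- move=> h1 sh1 ld1; have sz1 : size h1 = 4 by rewrite -(size_map size) -/(shape h1) sh1 sh0.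
  apply: (runs_new (rd' := fun l => l.1 != 2) (v := ovr (ovr uC uB) uA)) => //.
    by rewrite /=; lia.
  + by rewrite /=; lia.
  + by rewrite [den _ _]/=; lia.
  + move=> h2 sh2 ld2; have sz2 : size h2 = 5.
      by rewrite -(size_map size) -/(shape h2) sh2 size_rcons size_map sz1.
    apply: (runs_new (rd' := fun l => l.1 != 2) (v := ovr (ovr (ovr uC uP) uB) uA)) => //.
      by rewrite /=; lia.
    * by rewrite /=; lia.
    * by rewrite [den _ _]/=; lia.
    * move=> h3 sh3 ld3; rewrite sz1 sz2.
      apply: runs_le (runs_main_body pw mulH _ _ _) _ _ _.
      -- by rewrite -(size_map size) -/(shape h3) sh3 size_rcons size_map sz2.
      -- by rewrite sh3 sh2 sh1 sh0.
      -- by move=> l; rewrite ld3 ld2 ld1.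
      -- by rewrite /=; lia.
      -- by rewrite /=; lia.
      by rewrite [den _ _]/=; lia.
    * by move=> l; rewrite sz2 => lz; rewrite !ov /uP none //; case: (uC l).
    * by move=> l; rewrite sz2 => lz; rewrite !ov /uC /uB /uA !none ?lz.
    by move=> l _ ->; rewrite orbT.
  + by move=> l; rewrite sz1 => lz; rewrite !ov /uB none //; case: (uC l).
  + by move=> l; rewrite sz1 => lz; rewrite !ov /uC /uA !none ?lz.
  by move=> l _ ->; rewrite orbT.
- by move=> l lz; rewrite ov /uA none //; case: (uC l).
- by move=> l lz; rewrite /uC none ?lz.
by move=> l _ ->; rewrite orbT.
Qed.

Definition cutoff := up_log 7 d.+1.

Lemma cutoff_gt : d < 7 ^ cutoff.
Proof. exact: up_logP. Qed.

(** By minimality the preceding power of 7 is at most [d]. This side of the estimate keeps the span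
    linear in [d]; [cutoff_gt] is the side that makes the cutoff large enough for the space
    bound. *)
Lemma cutoff_le : 7 ^ cutoff <= 7 * d.+1.
Proof.
rewrite /cutoff; case: (posnP d) => [-> //|d0].
have := @up_log_gtn 7 d.+1 isT d0; have : 0 < up_log 7 d.+1 by rewrite up_log_gt0.
case: (up_log _ _) => // c _ /= le; rewrite expnS leq_mul2l /=; exact: ltnW.
Qed.

(** Ensures that [size_proc] does not stop its search before [d]. *)
Hypothesis d_min : forall i, n <= 2 ^ i -> d <= i.

(** The search counts up, so the induction is on the number [j] of iterations still to come. *)
Lemma runs_cut_loop j W S C : j <= cutoff -> mul_ok R w cutoff d W S C ->
  runs P w [:: cutoff - j; 7 ^ (cutoff - j); d; side; n] [:: 0; 1; 2] h0 cut_proc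
    uC (fun l => l.1 != 2) ms
    (W + 390 * (side * side) + 120 + 25 * j) (S + 600 * d.+1 + 120 + 25 * j)
    (C + 3 * (side * side)).
Proof.
move=> jc mulH; elim: j jc => [|j IH] jc.
  apply: runs_if; [by []|by []|by rewrite /=; lia|by rewrite /=; lia|].
  rewrite subn0 [den _ _ <= _]/= leqNgt cutoff_gt /=.
  by apply: runs_le (runs_cut_body _ mulH) _ _ _ => //; lia.
apply: runs_if; [by []|by []|by rewrite /=; lia|by rewrite /=; lia|].
rewrite [den _ _ <= _]/=.
have lt_c : 7 ^ (cutoff - j.+1) <= d.
  rewrite leqNgt; apply/negP => lt; have := up_log_min (isT : 1 < 7) lt.
  by rewrite -/cutoff; lia.
rewrite lt_c.
have cE : cutoff - j = (cutoff - j.+1).+1 by lia.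
have c_lt : cutoff - j.+1 < 7 ^ (cutoff - j.+1) by rewrite ltn_expl.
have d_lt : d < 28 ^ d by rewrite ltn_expl.
apply: runs_le; first apply: (runs_call_add (P := P) (p := p_cut) (K := 20)
  (c := cut_proc) erefl).
- by rewrite /=; clear -wb c_lt lt_c d_lt; lia.
- by [].
- by [].
- rewrite [map _ _]/= [map _ [:: 0; 1; 2]]/= -expnS addn1 -cE.
  by apply: IH; apply: ltnW.
- by rewrite /=; lia.
- by rewrite /=; lia.
exact: leqnn.
Qed.

Lemma runs_size_loop j W S C : j <= d -> mul_ok R w cutoff d W S C ->
  runs P w [:: d - j; 2 ^ (d - j); n] [:: 0; 1; 2] h0 size_proc
    uC (fun l => l.1 != 2) ms
    (W + 390 * (side * side) + 150 + 25 * cutoff + 25 * j)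
    (S + 600 * d.+1 + 150 + 25 * cutoff + 25 * j) (C + 3 * (side * side)).
Proof.
move=> jc mulH; elim: j jc => [|j IH] jc.
  apply: runs_if; [by []|by []|by rewrite /=; lia|by rewrite /=; lia|].
  rewrite subn0 [den _ _ <= _]/= nd.
  apply: runs_le; first apply: (runs_call_add (P := P) (p := p_cut) (K := 20)
    (c := cut_proc) erefl).
  - by rewrite /=; clear -wb; lia.
  - by [].
  - by [].
  - rewrite [map _ _]/= [map _ [:: 0; 1; 2]]/=.
    have := runs_cut_loop (leqnn _) mulH; rewrite subnn; apply.
  - by rewrite /=; lia.
  - by rewrite /=; lia.
  exact: leqnn.
apply: runs_if; [by []|by []|by rewrite /=; lia|by rewrite /=; lia|].
rewrite [den _ _ <= _]/= ifF; last by apply/negP => /d_min; lia.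
have cE : d - j = (d - j.+1).+1 by lia.
have p2 : 2 ^ (d - j.+1) + 2 ^ (d - j.+1) <= 28 ^ d.
  rewrite addnn -mul2n -expnS -cE (leq_trans _ (@leq_expl 2 28 d isT)) //.
  by rewrite leq_exp2l // leq_subr.
have d_lt : d < 28 ^ d by rewrite ltn_expl.
apply: runs_le; first apply: (runs_call_add (P := P) (p := p_size) (K := 20)
  (c := size_proc) erefl).
- by rewrite /=; clear -wb p2 d_lt; lia.
- by [].
- by [].
- rewrite [map _ _]/= [map _ [:: 0; 1; 2]]/= addn1 addnn -mul2n -expnS -cE.
  by apply: IH; apply: ltnW.
- by rewrite /=; lia.
- by rewrite /=; lia.
exact: leqnn.
Qed.

Lemma strassenW_runs : exists t : dag R,
  [/\ multiplies strassenW w A B t, race_free t, mults t = ms &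
    [/\ dag_work t <= mul_work d + 390 * (side * side) + 200 + 25 * cutoff + 25 * d,
        dag_span t <= mul_span cutoff d + 600 * d.+1 + 200 + 25 * cutoff + 25 * d &
        dag_space t <= mul_space cutoff d + 3 * (side * side)]].
Proof.
have w200 : 200 < w by lia.
have mulH := @mul_correct R w cutoff d w200.
move: (mul_work d) (mul_span _ _) (mul_space _ _) mulH => W S C mulH.
have run := runs_size_loop (leqnn d) mulH; rewrite subnn in run.
have [h' [t [ex sh ld [rf _ _ mu [cw cs cc]]]]] :
  runs P w [:: n] [:: 0; 1; 2] h0 (main strassenW) uC (fun l => l.1 != 2) ms
    (W + 390 * (side * side) + 200 + 25 * cutoff + 25 * d)
    (S + 600 * d.+1 + 200 + 25 * cutoff + 25 * d) (C + 3 * (side * side)).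
  apply: runs_le; first apply: (runs_call_add (P := P) (p := p_size) (K := 20)
    (c := size_proc) erefl).
  - by rewrite /=; lia.
  - by [].
  - by [].
  - by rewrite [map _ _]/= [map _ [:: 0; 1; 2]]/=; exact: run.
  - by lia.
  - by lia.
  exact: leqnn.
exists t; split=> //; rewrite /multiplies.
suff <- : h' = [:: row_major A; row_major B; row_major (A *m B)%R] by [].
apply: heap_ext; first by rewrite sh /shape /= !size_row_major size_nseq.
case=> b o; rewrite ld /ovr /uC /block_upd /=.
case: b => [|[|[|b]]] //= .
(* Only the result block differs from the initial heap; past its end both sides give the default
   [None]. *)
rewrite add0n /load /= row_majorE; case: (ltnP o (n * n)) => on.
  by rewrite nth_mkseq ?subn0.
by rewrite !nth_default ?size_mkseq ?size_nseq.
Qed.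

End Main.

Lemma mults_strassen (R : pzRingType) n (A B : 'M[R]_n) :
  smults (up_log 2 n) (mx_fun A) (mx_fun B) = strassen_mults A B.
Proof. by rewrite /strassen_mults !pad_to_mx strassen_smults. Qed.

Lemma pow_up_log_le n : 0 < n -> 2 ^ up_log 2 n <= 2 * n.
Proof.
case: n => [//|[//|n]] _; have := @up_log_gtn 2 n.+2 isT isT.
have : 0 < up_log 2 n.+2 by rewrite up_log_gt0.
case: (up_log _ _) => // c _ /= le; rewrite expnS leq_mul2l /=; exact: ltnW.
Qed.

(** From [28 <= 2 ^ 5] and [2 ^ up_log 2 n <= 2 * n <= n.+1 ^ 2] follows
    [28 ^ up_log 2 n <= n.+1 ^ 10]. A second factor [n.+1 ^ 10], which is at least 1024, absorbs the
    constants. *)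
Lemma word_size n : 0 < n -> 200 + 100 * 28 ^ up_log 2 n < n.+1 ^ 20.
Proof.
move=> n0; have x0 : 0 < 28 ^ up_log 2 n by rewrite expn_gt0.
have n2 : 2 <= n.+1 by [].
have le1 : 28 ^ up_log 2 n <= n.+1 ^ 10.
  apply: (@leq_trans ((2 ^ 5) ^ up_log 2 n)); first exact: leq_expl.
  rewrite -expnM mulnC expnM; apply: (@leq_trans ((n.+1 ^ 2) ^ 5)).
    apply: leq_expl; apply: leq_trans (pow_up_log_le n0) _.
    by rewrite expnS expn1 leq_mul.
  by rewrite -expnM.
have le2 : 2 ^ 10 <= n.+1 ^ 10 by apply: leq_expl.
have -> : n.+1 ^ 20 = n.+1 ^ 10 * n.+1 ^ 10 by rewrite -expnD.
apply: (@leq_trans (2 ^ 10 * 28 ^ up_log 2 n)); last exact: leq_mul.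
rewrite (_ : 2 ^ 10 = 1024) //; lia.
Qed.

(** * Asymptotics *)

Section NatBounds.
Variable d : nat.
Let cut := cutoff d.

Let cut_le : 7 ^ cut <= 7 * d.+1.
Proof. exact: cutoff_le. Qed.

Let cut_lt : cut < 7 ^ cut.
Proof. exact: ltn_expl. Qed.

Lemma work_bound :
  mul_work d + 390 * (2 ^ d * 2 ^ d) + 200 + 25 * cut + 25 * d <= 48 * 1000 * 7 ^ d.
Proof.
have d7 : d < 7 ^ d by rewrite ltn_expl.
have s7 : 2 ^ d * 2 ^ d <= 7 ^ d by rewrite -expnMn leq_expl.
have W : mul_work d <= 46 * 1000 * 7 ^ d by rewrite /mul_work leq_subr.
move: (mul_work d) W => W'; have := cut_le; have := cut_lt; clear -d7 s7; lia.
Qed.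

Lemma span_bound :
  mul_span cut d + 600 * d.+1 + 200 + 25 * cut + 25 * d <= 400 * 1000 * d.+1.
Proof.
have S : mul_span cut d = 11 * 1000 * d + 46 * 1000 * 7 ^ cut by [].
move: (mul_span cut d) S => S' S; have := cut_le; have := cut_lt; clear -S; lia.
Qed.

Lemma bernoulli67 x : (6 + x) * 6 ^ x <= 6 * 7 ^ x.
Proof. by elim: x => // x IH; rewrite !expnS; move: (6 ^ x) (7 ^ x) IH => *; nia. Qed.

(** The factor [cut] stands in for [log (log n)], which is at most [3 * cut]; this keeps the
    estimate within the natural numbers. *)
Lemma space_bound : 4 <= d ->
  (mul_space cut d + 3 * (2 ^ d * 2 ^ d)) * cut <= 3 * 1000 * 7 ^ d.
Proof.
move=> d4; set x := 4 * cut %/ 5.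
(* The top-level product is therefore a parallel one. Otherwise [7 ^ d] would be at most [7 * d.+1],
   yet it exceeds [49 * (d - 2)]. *)
have cd : cut < d.
  rewrite ltnNge; apply/negP => le.
  have l1 : 7 ^ d <= 7 * d.+1 by apply: leq_trans cut_le; rewrite leq_exp2l.
  have l2 : 49 * (d - 2) < 7 ^ d.
    have -> : 7 ^ d = 49 * 7 ^ (d - 2) by rewrite -[49]/(7 ^ 2) -expnD; congr expn; lia.
    by rewrite ltn_mul2l ltn_expl.
  by lia.
have xd : x <= d by rewrite /x; lia.
pose q := 255 * 7 ^ d * 6 ^ x.
have l1 : (mul_space cut d + 3 * (2 ^ d * 2 ^ d)) * 7 ^ x <= q.
  have s6 : 2 ^ d * 2 ^ d <= 6 ^ d by rewrite -expnMn leq_expl.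
  have P := pow67_le xd; rewrite leq_divRL ?expn_gt0 // in P.
  have s6' : 3 * (2 ^ d * 2 ^ d) * 7 ^ x <= 3 * (7 ^ d * 6 ^ x).
    by rewrite -mulnA leq_mul2l /= (leq_trans _ P) // leq_mul2r s6 orbT.
  rewrite mulnDl /mul_space -/x ifF ?mulnBl; last by rewrite leqNgt cd.
  have := leq_trunc_div (252 * 7 ^ d * 6 ^ x) (7 ^ x).
  rewrite /q; clear -s6'; lia.
(* Rounding gives [4 * cut <= 5 * x + 4], which is below [5 * (6 + x)], the form to which
   [bernoulli67] applies. *)
have l2 : 4 * cut * 6 ^ x <= 30 * 7 ^ x.
  apply: (@leq_trans (5 * ((6 + x) * 6 ^ x))).
    by rewrite mulnA leq_mul2r; apply/orP; right; rewrite /x; lia.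
  by have := bernoulli67 x; lia.
have x7 : 0 < 7 ^ x by rewrite expn_gt0.
rewrite -(leq_pmul2r x7) -mulnA [cut * _]mulnC mulnA.
apply: leq_trans (leq_mul l1 (leqnn cut)) _.
rewrite /q -!mulnA [6 ^ x * _]mulnC.
have : 7 ^ d * (cut * 6 ^ x) <= 7 ^ d * (8 * 7 ^ x) by rewrite leq_mul2l; apply/orP; right; lia.
clear; lia.
Qed.

End NatBounds.

Local Open Scope ring_scope.

Section RealBounds.
Variable K : realType.

Lemma ln2_gt0 : 0 < ln 2 :> K.
Proof. by rewrite ln_gt0 // ltr1n. Qed.

Lemma ler_log2 (x y : K) : 0 < x -> x <= y -> log2 x <= log2 y.
Proof.
move=> x0 xy; rewrite /log2 ler_pM2r ?invr_gt0 ?ln2_gt0 // ler_ln ?posrE //.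
exact: lt_le_trans xy.
Qed.

Lemma log2X k : log2 (2 ^+ k) = k%:R :> K.
Proof. by rewrite /log2 lnXn // -[_ *+ k]mulr_natl mulfK // gt_eqF ?ln2_gt0. Qed.

Lemma powR_log2_7 : 2 `^ log2 7 = 7 :> K.
Proof.
rewrite /powR pnatr_eq0 /= /log2 divfK ?gt_eqF ?ln2_gt0 //.
by rewrite lnK // posrE.
Qed.

(** Rewriting 7 as [2]^ log2 7[turns]7 ^ d[into](2 ^ d) [^ log2 7]; rounding [n] up to a power of
    two at most doubles it, which costs one factor 7. *)
Lemma pow7_up_log n : (0 < n)%N ->
  (7 ^ up_log 2 n)%:R <= 7 * n%:R `^ log2 7 :> K.
Proof.
move=> n0; have log7 : 0 <= log2 7 :> K.
  by apply: divr_ge0; apply: ln_ge0; rewrite ler1n.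
rewrite -[X in X * _]powR_log2_7 -powRM // natrX -[X in X ^+ _]powR_log2_7.
rewrite -powR_mulrn ?powR_ge0 // powRAC powR_mulrn //.
apply: ge0_ler_powR => //; rewrite ?nnegrE ?exprn_ge0 ?mulr_ge0 //.
by rewrite -natrX -natrM ler_nat pow_up_log_le.
Qed.

End RealBounds.

Unset Implicit Arguments.

Theorem theorem4 (K : realType) :
  exists (strassenW : program) (e : nat) (c : K) (N : nat),
  forall (R : pzRingType) (n : nat) (A B : 'M[R]_n), (0 < n)%N ->
  exists t : dag R,
    [/\ multiplies strassenW (n.+1 ^ e)%N A B t,
        race_free t,
        perm_eq (mults t) (strassen_mults A B) &
        (N <= n)%N ->
        [/\ (dag_work t)%:R <= c * n%:R `^ log2 7,
            (dag_span t)%:R <= c * (log2 n%:R * log2 (log2 (log2 n%:R))) &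
            (dag_space t)%:R <= c * (n%:R `^ log2 7 / log2 (log2 n%:R))]].
Proof.
(* One constant serves all three bounds: work needs [7 * 48 * 1000], span [600 * 1000] (as
   [d + 1 <= L + 2] and [L >= 4]), and space [3 * 7 * 3 * 1000]. The threshold 16 makes the iterated
   logarithms of [n] at least 4, 2 and 1. *)
pose M := (1000 * 1000)%N.
exists strassenW, 20%N, M%:R, 16%N => R n A B n0.
set d := up_log 2 n.
have nd : (n <= 2 ^ d)%N by apply: up_logP.
have dmin i : (n <= 2 ^ i)%N -> (d <= i)%N by apply: up_log_min.
have [t [mul rf mu [cw cs cc]]] := strassenW_runs A B n0 nd (word_size n0) dmin.
exists t; split=> //; first by rewrite mu mults_strassen perm_refl.
move=> n16.
have d4 : (4 <= d)%N.
  have : (2 ^ 4 <= 2 ^ d)%N by apply: leq_trans nd.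
  by rewrite leq_exp2l.
have nw := pow7_up_log K n0.
set X := n%:R `^ log2 7 in nw *; have X0 : 0 <= X by apply: powR_ge0.
have n0K : 0 < n%:R :> K by rewrite ltr0n.
set L := log2 (n%:R : K).
have L4 : 4 <= L.
  by rewrite -[4](@log2X K 4) ler_log2 ?exprn_gt0 // -natrX ler_nat.
have dL : d%:R <= L + 1.
  have d1 : (0 < d)%N by apply: leq_trans d4.
  have le : (2 ^ d.-1 <= n)%N by apply/ltnW/up_log_gtn => //; apply: leq_trans n16.
  have : log2 (2 ^+ d.-1) <= L by apply: ler_log2; rewrite ?exprn_gt0 // -natrX ler_nat.
  by rewrite log2X -{2}(prednK d1) -natr1; lra.
have Ld : L <= d%:R by rewrite -log2X ler_log2 // -natrX ler_nat.
set LL := log2 L.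
have LL2 : 2 <= LL.
  by rewrite -[2](@log2X K 2) ler_log2 ?exprn_gt0 // expr2; lra.
(* Indeed [L <= d < 7 ^ cutoff d <= 2 ^ (3 * cutoff d)]. *)
have LLc : LL <= (3 * cutoff d)%:R.
  rewrite -log2X ler_log2 //; first by lra.
  apply: le_trans Ld _; rewrite -natrX ler_nat expnM.
  by apply: leq_trans (ltnW (cutoff_gt d)) _; apply: leq_expl.
have LLL1 : 1 <= log2 LL.
  by rewrite -[1](@log2X K 1) ler_log2 ?exprn_gt0 // expr1.
have toK a b : (a <= b)%N -> a%:R <= b%:R :> K by rewrite ler_nat.
have ME : M%:R = 1000 * 1000 :> K by rewrite /M natrM.
clearbody M.
split.
- apply: le_trans (toK _ _ (leq_trans cw (work_bound d))) _.
  rewrite natrM (natrM _ 48) ME; move: nw X0; move: (7 ^ d)%N%:R => Y; lra.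
- apply: le_trans (toK _ _ (leq_trans cs (span_bound d))) _.
  (* The span is bounded by a multiple of [log n] alone; the last factor is then inserted because it
     is at least 1. *)
  apply: (@le_trans _ _ (M%:R * L)).
    rewrite ME (natrM _ (400 * 1000)) (natrM _ 400 1000) -(natr1 d); move: (d%:R) dL => Y; lra.
  rewrite ler_wpM2l ?ler0n // -[leLHS]mulr1 ler_wpM2l //; lra.
have LL0 : 0 < LL by lra.
rewrite mulrA ler_pdivlMr //.
have := toK _ _ (leq_trans (leq_mul cc (leqnn (cutoff d))) (space_bound d4)).
rewrite !natrM ME => sp.
apply: le_trans (ler_wpM2l (ler0n _ _) LLc) _; rewrite natrM.
move: (dag_space t)%:R (cutoff d)%:R sp => Y Z; move: nw X0; move: (7 ^ d)%N%:R => V; nra.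
Qed.
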